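(* Let $(a,b)\subset\mathbb{R}$ be an interval and let $\mathbb{R}^{n-1}\times(a,b)$ carry the smooth density $\delta=e^{\varphi(x)+\psi(x_n)}$, where $x=(x_1,\dots,x_{n-1})$, $\varphi:\mathbb{R}^{n-1}\to\mathbb{R}$ and $\psi:(a,b)\to\mathbb{R}$ are smooth. If $\psi$ is convex, then every horizontal hyperplane $\{x_n=c\}$, $c\in(a,b)$, is weighted area-minimizing in $\mathbb{R}^{n-1}\times(a,b)$.
   Context: The density $\delta$ weights both volume and hypersurface area: weighted volume is $\int \delta\, dV$ and weighted area is $\mathrm{Area}_\delta(\Sigma)=\int_\Sigma \delta\, dA$, with $dV,dA$ Euclidean. Let $\mathcal U$ be the ambient region and $\Sigma\subset\mathcal U$ a hypersurface bounding an open region $\Omega\subset\mathcal U$ in $\mathcal U$ (here $\Omega=\{x_n<c\}\cap\mathcal U$, $\Sigma=\{x_n=c\}$). ''Weighted area-minimizing'' means having least weighted area under compact, weighted-volume-preserving deformations: for every hypersurface $\overline\Sigma\subset\mathcal U$ obtained from $\Sigma$ by a deformation of $\mathcal U$ supported in a compact set $K\subset\mathcal U$, carrying $\Omega$ to a region $\overline\Omega$ bounded by $\overline\Sigma$ with $\int_{\overline\Omega\setminus\Omega}\delta\, dV=\int_{\Omega\setminus\overline\Omega}\delta\, dV$, one has $\mathrm{Area}_\delta(\Sigma\cap K)\le\mathrm{Area}_\delta(\overline\Sigma\cap K)$. *)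

(* Defs.v *)
From HB Require Import structures.
From mathcomp Require Import all_boot all_order all_algebra.
From mathcomp Require Import all_classical all_reals all_analysis.
Import Order.TTheory GRing.Theory Num.Theory.
Import numFieldNormedType.Exports.

Set Implicit Arguments.
Unset Strict Implicit.
Unset Printing Implicit Defensive.

Local Open Scope classical_set_scope.
Local Open Scope ring_scope.

Definition rV_display : measure_display.
Proof. exact: default_measure_display. Qed.

Section measurable_rV.
Context {R : realType}.
Variable n : nat.

Let coord (i : 'I_n) (v : 'rV[R]_n) : measurableTypeR R := v ord0 i.

Let rV_set0 : g_sigma_preimage coord set0.
Proof. exact: sigma_algebra0. Qed.

Let rV_setC A : g_sigma_preimage coord A -> g_sigma_preimage coord (~` A).
Proof. exact: sigma_algebraC. Qed.

Let rV_bigcup (F : _^nat) : (forall i, g_sigma_preimage coord (F i)) ->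
  g_sigma_preimage coord (\bigcup_i (F i)).
Proof. exact: sigma_algebra_bigcup. Qed.

HB.instance Definition _ := @isMeasurable.Build rV_display
  'rV[R]_n (g_sigma_preimage coord) rV_set0 rV_setC rV_bigcup.

End measurable_rV.

Lemma measurable_rV_coord (R : realType) n (i : 'I_n) :
  measurable_fun [set: 'rV[R]_n]
    (fun v : 'rV[R]_n => (v ord0 i : measurableTypeR R)).
Proof.
move=> _ Y mY; rewrite setTI; apply: sub_sigma_algebra => /=.
rewrite -bigcup_seq/=; exists i => /=; first by rewrite mem_index_enum.
by exists Y => //; rewrite setTI.
Qed.

Lemma measurable_fun_rVP d (T : measurableType d) (R : realType) n
    (f : T -> 'rV[R]_n) :
  (forall i, measurable_fun [set: T]
     (fun x => (f x ord0 i : measurableTypeR R))) ->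
  measurable_fun [set: T] f.
Proof.
move=> mf _ A mA; rewrite setTI; move: A mA.
suff H : (@measurable _ 'rV[R]_n) `<=` [set A | measurable (f @^-1` A)].
  by move=> A mA; exact: (H A).
apply: smallest_sub.
  split => /=.
  - by rewrite preimage_set0.
  - by move=> A mA; rewrite setTD preimage_setC; exact: measurableC.
  - by move=> F mF; rewrite preimage_bigcup; exact: bigcupT_measurable.
move=> A; rewrite -bigcup_seq => -[i _ [B mB <-]] /=.
rewrite setTI -comp_preimage -[X in measurable X]setTI.
exact: mf.
Qed.

Section lebesgue_rV.
Context {R : realType}.

(* R x R^n ~ R^(n+1), the real number becoming the first coordinate. *)
Definition rV_cons n (p : measurableTypeR R * 'rV[R]_n) : 'rV[R]_n.+1 :=
  \row_i oapp (fun j => p.2 ord0 j) p.1 (unlift ord0 i).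

Definition rV_uncons n (v : 'rV[R]_n.+1) : measurableTypeR R * 'rV[R]_n :=
  (v ord0 ord0, \row_j v ord0 (lift ord0 j)).

Lemma rV_consK n : cancel (@rV_cons n) (@rV_uncons n).
Proof.
move=> [x v]; rewrite /rV_cons /rV_uncons /=; congr pair.
  by rewrite mxE unlift_none.
by apply/rowP => j; rewrite !mxE liftK.
Qed.

Lemma measurable_rV_cons n : measurable_fun setT (@rV_cons n).
Proof.
apply: measurable_fun_rVP => i.
have [j ->|->] := unliftP ord0 i.
  under eq_fun do rewrite mxE liftK /=.
  apply: (@measurableT_comp _ _ _ _ _ _
    (fun v : 'rV[R]_n => (v ord0 j : measurableTypeR R))) => //.
  exact: measurable_rV_coord.
under eq_fun do rewrite mxE unlift_none /=.
exact: measurable_fst.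
Qed.

Lemma measurable_rV_uncons n : measurable_fun setT (@rV_uncons n).
Proof.
apply: measurable_fun_pair => /=; first exact: measurable_rV_coord.
apply: measurable_fun_rVP => i.
under eq_fun do rewrite mxE.
exact: measurable_rV_coord.
Qed.

Section step.
Variables (n : nat) (mu : {sigma_finite_measure set 'rV[R]_n -> \bar R}).

Definition lebesgue_rV_succ : set 'rV[R]_n.+1 -> \bar R :=
  pushforward (@lebesgue_measure R \x mu)%E (@rV_cons n).

Let pushed : {measure set 'rV[R]_n.+1 -> \bar R} :=
  measure_function_pushforward__canonical__measure_function_Measure
    (lebesgue_measure \x mu)%E (@measurable_rV_cons n).

Let nu0 : lebesgue_rV_succ set0 = 0%E.
Proof. exact: (measure0 pushed). Qed.

Let nu_ge0 A : (0 <= lebesgue_rV_succ A)%E.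
Proof. exact: (measure_ge0 pushed). Qed.

Let nu_sigma_additive : semi_sigma_additive lebesgue_rV_succ.
Proof. exact: (@measure_semi_sigma_additive _ _ _ pushed). Qed.

HB.instance Definition _ := isMeasure.Build _ _ _ lebesgue_rV_succ
  nu0 nu_ge0 nu_sigma_additive.

Let nu_sigma_finite : sigma_finite setT lebesgue_rV_succ.
Proof.
pose leb : {sigma_finite_measure set (measurableTypeR R) -> \bar R} :=
  lebesgue_measure.
have /sigma_finiteP[F [TF ndF Foo]] := sigma_finiteT leb.
have /sigma_finiteP[G [TG ndG Goo]] := sigma_finiteT mu.
exists (fun k => @rV_uncons n @^-1` (F k `*` G k)).
  rewrite -preimage_bigcup; apply/seteqP; split => // v _ /=.
  have [i _ Fi] : (\bigcup_i F i) (rV_uncons v).1 by rewrite -TF.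
  have [j _ Gj] : (\bigcup_i G i) (rV_uncons v).2 by rewrite -TG.
  exists (maxn i j) => //; split.
    by move: Fi; exact/subsetPset/ndF/leq_maxl.
  by move: Gj; exact/subsetPset/ndG/leq_maxr.
move=> k; have [mF Fk] := Foo k; have [mG Gk] := Goo k; split.
  rewrite -[X in measurable X]setTI; apply: measurable_rV_uncons => //.
  exact: measurableX.
rewrite /lebesgue_rV_succ /pushforward -comp_preimage (_ : _ \o _ = id); last first.
  by apply/funext => p /=; rewrite rV_consK.
rewrite preimage_id (product_measure1E leb)//.
by rewrite lte_mul_pinfty// ge0_fin_numE.
Qed.

HB.instance Definition _ := Measure_isSigmaFinite.Build _ _ _ lebesgue_rV_succ
  nu_sigma_finite.

End step.

Fixpoint lebesgue_rV n : {sigma_finite_measure set 'rV[R]_n -> \bar R} :=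
  match n with
  | 0 => \d_ (0 : 'rV[R]_0)
  | n'.+1 => lebesgue_rV_succ (lebesgue_rV n')
  end.

End lebesgue_rV.

(* The library norm of ['rV[R]_m * R] is the sup norm. *)
Definition edist (R : realType) m (p q : 'rV[R]_m * R) : R :=
  Num.sqrt (\sum_(i < m) (p.1 ord0 i - q.1 ord0 i) ^+ 2 + (p.2 - q.2) ^+ 2).

(* Volume of the unit ball of R^k. *)
Definition ball_volume (R : realType) k : R :=
  fine (lebesgue_rV k [set v : 'rV[R]_k | \sum_(i < k) v ord0 i ^+ 2 <= 1]).

Section hausdorff.
Context {R : realType} {m : nat}.
Notation E := ('rV[R]_m * R)%type.
Variable k : nat.
Local Open Scope ereal_scope.

(* [diameter set0 = -oo]. *)
Definition diameter (A : set E) : \bar R :=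
  ereal_sup [set (edist p.1 p.2)%:E | p in A `*` A].

(* The empty set must be treated apart, since [x ^+ 0 = 1]. *)
Definition hausdorff_gauge (A : set E) : \bar R :=
  if A == set0 then 0
  else (ball_volume R k / 2 ^+ k)%:E * diameter A ^+ k.

Definition hausdorff_cover (e : R) (A : set E) : set ((set E)^nat) :=
  [set C | (forall i, diameter (C i) <= e%:E) /\ A `<=` \bigcup_i C i].

Definition hausdorff_pre (e : R) (A : set E) : \bar R :=
  ereal_inf [set \sum_(i <oo) hausdorff_gauge (C i) | C in hausdorff_cover e A].

Definition hausdorff (A : set E) : \bar R :=
  ereal_sup [set hausdorff_pre e A | e in [set e | (0 < e)%R]].

Lemma ball_volume_ge0 : (0 <= ball_volume R k)%R.
Proof. by rewrite fine_ge0. Qed.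

Lemma diameter_ge0 A : A != set0 -> 0 <= diameter A.
Proof.
move=> /set0P[x Ax]; apply: (@le_trans _ _ (edist x x)%:E).
  by rewrite lee_fin sqrtr_ge0.
by apply: ereal_sup_ubound; exists (x, x).
Qed.

Lemma hausdorff_gauge0 : hausdorff_gauge set0 = 0.
Proof. by rewrite /hausdorff_gauge eqxx. Qed.

Lemma hausdorff_gauge_ge0 A : 0 <= hausdorff_gauge A.
Proof.
rewrite /hausdorff_gauge; case: ifPn => // A0.
apply: mule_ge0; last exact/expe_ge0/diameter_ge0.
by rewrite lee_fin divr_ge0 ?ball_volume_ge0 ?exprn_ge0.
Qed.

Lemma hausdorff_pre_ge0 e A : 0 <= hausdorff_pre e A.
Proof.
apply: le_ereal_inf_tmp => _ [C _ <-]; apply: nneseries_ge0 => i _ _.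
exact: hausdorff_gauge_ge0.
Qed.

Lemma hausdorff_pre0 e : hausdorff_pre e set0 = 0.
Proof.
apply/eqP; rewrite eq_le hausdorff_pre_ge0 andbT.
apply: ereal_inf_lbound; exists (fun=> set0).
  split=> // i; rewrite /diameter set0X image_set0 ereal_sup0.
  exact: leNye.
by apply: eseries0 => i _ _; rewrite hausdorff_gauge0.
Qed.

Lemma le_hausdorff_pre e :
  {homo hausdorff_pre e : A B / A `<=` B >-> A <= B}.
Proof.
move=> A B AB; apply/ereal_inf_le_tmp => _ [C [dC BC] <-].
by exists C => //; split => //; exact: subset_trans BC.
Qed.

Lemma hausdorff_pre_sigma_subadditive e : sigma_subadditive (hausdorff_pre e).
Proof.
move=> A; have [[i ioo]|] := pselect (exists i, hausdorff_pre e (A i) = +oo).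
  rewrite (eseries_pinfty _ _ ioo) ?leey// => n _.
  by rewrite -ltNye (lt_le_trans _ (hausdorff_pre_ge0 _ _)).
rewrite -forallNE => Aoo.
suff add2e (r : {posnum R}) : hausdorff_pre e (\bigcup_n A n) <=
    \sum_(i <oo) hausdorff_pre e (A i) + r%:num%:E.
  by apply/lee_addgt0Pr => _/posnumP[].
rewrite (le_trans _ (epsilon_trick _ _ _))//; last first.
  by move=> n; exact: hausdorff_pre_ge0.
pose P n (B : (set E)^nat) := hausdorff_cover e (A n) B /\
  \sum_(j <oo) hausdorff_gauge (B j) <=
    hausdorff_pre e (A n) + (r%:num / (2 ^ n.+1)%:R)%:E.
have [G PG] : {G : ((set E)^nat)^nat & forall n, P n (G n)}.
  apply: (@choice _ _ P) => n.
  have finA : hausdorff_pre e (A n) \is a fin_num.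
    by rewrite ge0_fin_numE ?hausdorff_pre_ge0// ltey; exact/eqP/Aoo.
  have rn : (0 < r%:num / (2 ^ n.+1)%:R)%R by [].
  have [_ [B AB <-] Br] := lb_ereal_inf_adherent rn finA.
  by exists B; split => //; exact: ltW.
have G_ge0 x : 0 <= (hausdorff_gauge \o uncurry G) x.
  exact: hausdorff_gauge_ge0.
apply: (@le_trans _ _ (\esum_(i in setT) (hausdorff_gauge \o uncurry G) i)).
  apply: ereal_inf_lbound => /=.
  have /card_esym/ppcard_eqP[f] := card_nat2.
  exists (uncurry G \o f).
    split => [i|].
      by rewrite /= /uncurry; case: (f i) => a b; exact: (PG a).1.1.
    apply: (@subset_trans _ (\bigcup_n \bigcup_j G n j)) => [t [i _]|].
      by move=> /((PG i).1.2) [j _ ?]; exists i => //; exists j.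
    move=> t [i _ [j _ Bijt]]; exists (f^-1%FUN (i, j)) => //=.
    by rewrite invK ?inE.
  rewrite -(esum_pred_image (hausdorff_gauge \o uncurry G) _ xpredT) ?[fun=> _]set_true//.
  by rewrite image_eq.
rewrite (_ : esum _ _ =
    \sum_(i <oo) \sum_(j <oo) hausdorff_gauge (G i j)); last first.
  pose J : nat -> set (nat * nat) := fun i => [set (i, j) | j in setT].
  rewrite (_ : setT = \bigcup_j J j); last first.
    by rewrite predeqE => -[a b]; split => // _; exists a => //; exists b.
  rewrite esum_bigcupT /=; last 2 first.
    - apply/trivIsetP => i j _ _ ij.
      rewrite predeqE => -[n l] /=; split => //= -[] [_] _ [<-{n} _].
      by move=> [l' _] [] /esym/eqP; rewrite (negbTE ij).
    - by move=> /= [n l]; exact: hausdorff_gauge_ge0.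
  rewrite -(image_id [set: nat]) -fun_true esum_pred_image//; last first.
    by move=> n _; apply: esum_ge0 => p _; exact: (G_ge0 p).
  apply: eq_eseriesr => /= j _.
  rewrite -(esum_pred_image (hausdorff_gauge \o uncurry G) (pair j) predT)//=; last 2 first.
  - by move=> l _; exact: (G_ge0 (j, l)).
  - by move=> ? ? _ _; exact: (@can_inj _ _ _ snd).
  by congr esum; rewrite predeqE => -[a b]; split; move=> [i _ <-]; exists i.
apply: lee_nneseries => n _.
- by move=> _; apply: nneseries_ge0 => j _ _; exact: (G_ge0 (n, j)).
- exact: (PG n).2.
Qed.

Lemma hausdorff0 : hausdorff set0 = 0.
Proof.
apply/eqP; rewrite eq_le; apply/andP; split.
  by apply: ge_ereal_sup => _ [e _ <-]; rewrite hausdorff_pre0.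
apply: (le_trans (hausdorff_pre_ge0 1 set0)).
by apply: ereal_sup_ubound; exists 1%R => //=; exact: ltr01.
Qed.

Lemma hausdorff_ge0 A : 0 <= hausdorff A.
Proof.
apply: (le_trans (hausdorff_pre_ge0 1 A)).
by apply: ereal_sup_ubound; exists 1%R => //=; exact: ltr01.
Qed.

Lemma le_hausdorff : {homo hausdorff : A B / A `<=` B >-> A <= B}.
Proof.
move=> A B AB; apply: ge_ereal_sup => _ [e e0 <-].
apply: (le_trans (le_hausdorff_pre e AB)).
by apply: ereal_sup_ubound; exists e.
Qed.

Lemma hausdorff_sigma_subadditive : sigma_subadditive hausdorff.
Proof.
move=> A; apply: ge_ereal_sup => _ [e e0 <-].
apply: (le_trans (hausdorff_pre_sigma_subadditive e A)).
apply: lee_nneseries => [i _ _|i _]; first exact: hausdorff_pre_ge0.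
by apply: ereal_sup_ubound; exists e.
Qed.

HB.instance Definition _ := isOuterMeasure.Build R E hausdorff
  hausdorff0 hausdorff_ge0 le_hausdorff hausdorff_sigma_subadditive.

End hausdorff.

(* C^oo on an open set [D]: all iterated directional derivatives exist and are
   (Frechet) differentiable on [D]; values of [f] off [D] are irrelevant. *)
Definition smooth_on (R : realType) (V W : normedModType R) (D : set V)
    (f : V -> W) : Prop :=
  forall (vs : seq V) (x : V), D x ->
    differentiable (foldr (fun v (g : V -> W) => 'D_v g : V -> W) f vs) x.

Definition diffeomorphism_of (R : realType) (V : normedModType R) (U : set V)
    (f : V -> V) : Prop :=
  exists g : V -> V,
    [/\ set_fun U U f, set_fun U U g, smooth_on U f, smooth_on U g &
        (forall x, U x -> g (f x) = x) /\ (forall x, U x -> f (g x) = x)].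

(* An isotopy of [U] starting at the identity, supported in [K]; only the
   values of [F] on [0, 1] x U matter. *)
Definition deformation (R : realType) (V : normedModType R) (U K : set V)
    (F : R -> V -> V) : Prop :=
  [/\ forall x, U x -> F 0 x = x,
      forall t, 0 <= t <= 1 -> diffeomorphism_of U (F t),
      forall t x, 0 <= t <= 1 -> U x -> ~ K x -> F t x = x &
      {within `[0, 1] `*` U, continuous (fun p : R * V => F p.1 p.2)}].

Section weighted.
Context {R : realType} {m : nat}.
Notation E := ('rV[R]_m * R)%type.

Definition weighted_volume (delta : E -> R) (A : set E) : \bar R :=
  (\int[(lebesgue_rV m \x lebesgue_measure)]_(z in A) (delta z)%:E)%E.

(* Euclidean hypersurface area is the m-dimensional Hausdorff measure of
   R^m x R, on its Caratheodory sigma-algebra. *)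
Definition weighted_area (delta : E -> R) (S : set E) : \bar R :=
  (\int[hausdorff m : set (caratheodory_type (@hausdorff R m m)) -> \bar R]_(z in S)
     (delta z)%:E)%E.

Definition bounds_in (U S Omega : set E) : Prop :=
  [/\ open Omega, Omega `<=` U & S = U `&` (closure Omega `\` Omega°)].

Definition weighted_area_minimizing (delta : E -> R) (U S Omega : set E)
    : Prop :=
  bounds_in U S Omega /\
  forall (K : set E) (F : R -> E -> E),
    compact K -> K `<=` U -> deformation U K F ->
    let S' := F 1 @` S in
    let Omega' := F 1 @` Omega in
    weighted_volume delta (Omega' `\` Omega) =
      weighted_volume delta (Omega `\` Omega') ->
    (weighted_area delta (S `&` K) <= weighted_area delta (S' `&` K))%E.

Definition product_density (phi : 'rV[R]_m -> R) (psi : R -> R) (z : E) : R :=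
  expR (phi z.1 + psi z.2).

End weighted.

(* Possibly unbounded open interval. *)
Definition oo_interval (R : realType) (a b : \bar R) : set R :=
  [set t | (a < t%:E)%E /\ (t%:E < b)%E].

Definition slab (R : realType) m (a b : \bar R) : set ('rV[R]_m * R) :=
  setT `*` oo_interval a b.

Arguments slab {R} m a b.

(* Main.v *)
Require Import Defs.
From HB Require Import structures.
From mathcomp Require Import all_boot all_order all_algebra.
From mathcomp Require Import all_classical all_reals all_analysis.
From mathcomp Require Import measurable_realfun ring lra.
Import Order.TTheory GRing.Theory Num.Theory.
Import numFieldNormedType.Exports.
Local Open Scope classical_set_scope.
Local Open Scope ring_scope.
Set Implicit Arguments.
Unset Strict Implicit.
Unset Printing Implicit Defensive.

(** The weight [expR (phi x + psi t)] is a product, so the problem can be studied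
    on one vertical line at a time.  Let [f] be the final diffeomorphism of the
    deformation, [g] its inverse and [eta z] the height of [g z]: the deformed
    region is [eta < c], the deformed surface is [eta = c], and [eta z = z.2]
    away from the compact set [K].  On the line above [x] choose one point
    [(x, T x)] of the deformed surface: the last crossing of the level [c] if
    [psi' c >= 0], the first crossing if [psi' c < 0].  Since [psi'] is
    nondecreasing, [expR (psi v) - expR (psi u)], the integral of
    [psi' * expR psi], compares with [psi' c] times the integral of [expR psi]
    over [`[u, v]], in one direction above [c] and in the other below it
    ([weighted_length_comparison]).  Applied between [c] and [T x], it says that
    [expR (psi (T x)) - expR (psi c)] is at least [psi' c] times the net weighted
    length gained by the deformed region on that line; the choice of the first or
    of the last crossing is what makes the other pieces of the region contribute
    with the favourable sign.  Integrating over [x] against [expR (phi x)], the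
    net gains add up to zero because the deformation preserves volume
    ([base_integral_le]).  Hence the integral of the weight at height [T] over
    the base is at least the one at height [c].

    It remains to pass from integrals over the base to Hausdorff areas, which is
    done by comparing with the flat measure [flat_area c], the Hausdorff measure
    of the part of the hyperplane [{t = c}] above a given set.  The projection
    onto that hyperplane contracts distances, so that the graph of [T] has at
    least the flat area of its base ([flat_area_le_graph_area]).  The flat
    measure is invariant under translations and finite on cubes, hence a multiple
    of Lebesgue measure ([flat_area_lebesgue]); the same factor appears on both
    sides of the inequality.  These areas are integrals over the Caratheodory
    sigma-algebra of the Hausdorff measure, which contains the Borel sets because
    the Hausdorff measure is additive on sets at a positive distance
    ([caratheodory_sublevel], [hausdorff_separated]). *)

(** * Hausdorff measure as a metric outer measure *)

(** The Caratheodory criterion for metric outer measures, in the form needed for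
    a sublevel set of one function.  Cut [{s < f}] into shells on which [f] lies
    between consecutive terms of a sequence decreasing to [s].  Every other shell
    is separated from the previous ones, so each of the two interleaved families
    has total measure at most that of [X]; the tail of the series of shells
    therefore tends to 0, and up to that tail [{s < f}] is separated from
    [{f <= s}]. *)
Lemma caratheodory_sublevel (R : realType) (T : Type)
    (mu : {outer_measure set T -> \bar R}) (f : T -> R) (s : R) :
  (forall (A B : set T) (u v : R), u < v -> A `<=` [set x | f x <= u] ->
    B `<=` [set x | v < f x] -> (mu A + mu B <= mu (A `|` B))%E) ->
  mu.-caratheodory [set x | f x <= s].
Proof.
move=> sep; apply: le_caratheodory_measurable => X.
have [Xoo|] := boolP (mu X < +oo)%E; last first.
  by rewrite -leNgt leye_eq => /eqP ->; rewrite leey.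
pose a (n : nat) : R := s + n.+1%:R^-1.
have a_lt n k : (n < k)%N -> a k < a n.
  by move=> nk; rewrite ltrD2l ltf_pV2 ?posrE// ltr_nat.
have s_a n : s < a n by rewrite ltrDl.
pose Y n := X `&` [set x | a n < f x].
pose S n := X `&` [set x | a n.+1 < f x <= a n].
have shells j N : (\sum_(0 <= n < N) mu (S (n.*2 + j).+1) <= mu (Y (N.*2 + j)%N))%E.
  elim: N => [|N IH]; first by rewrite big_nil outer_measure_ge0.
  rewrite big_nat_recr//= addeC.
  apply: (@le_trans _ _ (mu (S (N.*2 + j).+1) + mu (Y (N.*2 + j)%N)))%E.
    by rewrite leeD2l.
  apply: (le_trans (sep _ _ _ _ (a_lt _ _ (ltnSn (N.*2 + j))) _ _)).
  - by move=> x [_ /= /andP[]].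
  - by move=> x [].
  apply: le_outer_measure => x [[Xx /= /andP[+ _]]|[Xx /= fx]]; split => //=.
  apply: lt_trans fx; apply: a_lt.
  by rewrite doubleS !addSn ltnW.
have S0 n : (0 <= mu (S n))%E by exact: outer_measure_ge0.
have shells' j : (\sum_(0 <= n <oo) mu (S (n.*2 + j).+1) <= mu X)%E.
  apply: lime_le; first exact: is_cvg_nneseries.
  apply: nearW => N; apply: (le_trans (shells j N)).
  by apply: le_outer_measure => x [].
have fin : (\sum_(0 <= n <oo) mu (S n.+1) < +oo)%E.
  apply: (@le_lt_trans _ _ (mu X + mu X)%E); last by rewrite lte_add_pinfty.
  apply: lime_le; first exact: is_cvg_nneseries.
  apply: nearW => N.
  apply: (@le_trans _ _ (\sum_(0 <= n < N.*2) mu (S n.+1))%E).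
    rewrite -addnn [leRHS](@big_cat_nat _ _ _ N)//= ?leq_addr//.
    by rewrite leeDl// sume_ge0.
  have -> : (\sum_(0 <= n < N.*2) mu (S n.+1) =
     \sum_(0 <= n < N) mu (S (n.*2 + 0).+1) + \sum_(0 <= n < N) mu (S (n.*2 + 1).+1))%E.
    elim: N => [|N IH]; first by rewrite !big_nil adde0.
    rewrite doubleS !big_nat_recr//= IH addn0 addn1.
    by rewrite -!addeA; congr (_ + _)%E; rewrite addeCA.
  by apply: leeD; apply: (le_trans (shells _ N)); apply: le_outer_measure => x [].
have tail : (\sum_(N <= n <oo) mu (S n.+1) @[N --> \oo] --> 0)%E.
  exact: nneseries_tail_cvg.
set A := [set x | f x <= s].
have main N : (mu (X `&` A) + mu (X `&` ~` A) <=
    mu X + \sum_(N <= n <oo) mu (S n.+1))%E.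
  apply: (@le_trans _ _ (mu (X `&` A) + (mu (Y N.+1) + \sum_(N <= n <oo) mu (S n.+1))))%E.
    rewrite leeD2l//.
    apply: (@le_trans _ _ (mu (Y N.+1 `|` \bigcup_(n in [set k | (N <= k)%N]) S n.+1))).
      apply: le_outer_measure => x [Xx /= /negP]; rewrite -ltNge => sfx.
      have [fx|fx] := ltP (a N.+1) (f x); first by left; split.
      right.
      have ex : exists n, (N < n)%N && (a n.+1 < f x).
        have [k hk] := ltr_add_invr sfx.
        exists (maxn N.+1 k); rewrite leq_maxl/=.
        apply: le_lt_trans hk; rewrite lerD2l.
        by rewrite lef_pV2 ?posrE// ler_nat ltnS ltnW// ltnS leq_maxr.
      case: (ex_minnP ex) => -[//|n] /andP[Nn an] mn.
      exists n; first by [].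
      split=> //=; rewrite an/=.
      have [->//|nN] := eqVneq n N.
      rewrite leNgt; apply/negP => h.
      have := mn n; rewrite h andbT ltn_neqAle eq_sym nN -ltnS Nn => /(_ isT).
      by rewrite ltnn.
    apply: (le_trans (outer_measureU2 _ _ _)).
    rewrite leeD2l//.
    have := outer_measure_sigma_subadditive_tail mu N (fun n => S n.+1).
    apply: le_trans; apply: le_outer_measure => x [n Nn Sx].
    by exists n => //=; apply/negP; rewrite -leqNgt.
  rewrite addeA leeD2r//.
  apply: (le_trans (sep _ _ _ _ (s_a N.+1) _ _)).
  - by move=> x [].
  - by move=> x [].
  by apply: le_outer_measure => x [[]|[]].
have cv : (mu X + \sum_(N <= n <oo) mu (S n.+1) @[N --> \oo] --> mu X + 0)%E.
  apply: cvgeD => //; last exact: cvg_cst.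
  by rewrite fin_num_adde_defl.
rewrite -[leRHS]adde0 -(cvg_lim _ cv)//; apply: lime_ge (cvgP _ cv) _.
exact: nearW.
Qed.

(* The Euclidean distance, as opposed to the extended metric of the same name. *)
Local Notation edist := Defs.edist.

Section edist.
Context {R : realType} {m : nat}.
Notation E := ('rV[R]_m * R)%type.
Implicit Types p q : E.

Lemma edist_coord p q i : `|p.1 ord0 i - q.1 ord0 i| <= edist p q.
Proof.
rewrite -sqrtr_sqr ler_sqrt; last first.
  by rewrite addr_ge0 ?sqr_ge0// sumr_ge0// => *; rewrite sqr_ge0.
rewrite (bigD1 i)//= -addrA lerDl addr_ge0 ?sqr_ge0// sumr_ge0// => *.
by rewrite sqr_ge0.
Qed.

Lemma edist_snd p q : `|p.2 - q.2| <= edist p q.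
Proof.
rewrite -sqrtr_sqr ler_sqrt; last first.
  by rewrite addr_ge0 ?sqr_ge0// sumr_ge0// => *; rewrite sqr_ge0.
by rewrite lerDr sumr_ge0// => *; rewrite sqr_ge0.
Qed.

Lemma edist_flat c p q : edist (p.1, c) (q.1, c) <= edist p q.
Proof.
rewrite ler_sqrt; last first.
  by rewrite addr_ge0 ?sqr_ge0// sumr_ge0// => *; rewrite sqr_ge0.
by rewrite lerD2l subrr expr0n/= sqr_ge0.
Qed.

Lemma edist_shift (v : 'rV[R]_m) p q : edist (p.1 + v, p.2) (q.1 + v, q.2) = edist p q.
Proof.
rewrite /edist; congr (Num.sqrt (_ + _)); apply: eq_bigr => i _ /=.
by rewrite !mxE opprD addrACA subrr addr0.
Qed.

End edist.

Section hausdorff_theory.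
Context {R : realType} {m : nat}.
Notation E := ('rV[R]_m * R)%type.
Variable k : nat.
Local Open Scope ereal_scope.
Implicit Types A B C : set E.

Lemma expe_homo (x y : \bar R) n : 0 <= x -> x <= y -> x ^+ n <= y ^+ n.
Proof.
move=> x0 xy; elim: n => [|n IH]; first by rewrite !expe0.
by rewrite !expeS; apply: lee_pmul => //; exact: expe_ge0.
Qed.

Lemma le_diameter A B : A `<=` B -> diameter A <= diameter B.
Proof.
move=> AB; apply: ereal_sup_le; apply: image_subset => -[x y] [/= ? ?].
by split; exact: AB.
Qed.

Lemma diameter_image (f : E -> E) A :
  (forall p q, (edist (f p) (f q) <= edist p q)%R) ->
  diameter (f @` A) <= diameter A.
Proof.
move=> fC; apply: ge_ereal_sup => _ [[_ _] [/= [p Ap <-] [q Aq <-]] <-].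
apply: (@le_trans _ _ (edist p q)%:E); first by rewrite lee_fin.
by apply: ereal_sup_ubound; exists (p, q).
Qed.

Lemma le_hausdorff_gauge A B : (A !=set0 -> B !=set0) -> diameter A <= diameter B ->
  hausdorff_gauge k A <= hausdorff_gauge k B.
Proof.
move=> AB dAB; rewrite /hausdorff_gauge.
have [_|A0] := eqVneq A set0; first exact: hausdorff_gauge_ge0.
have /negbTE -> : B != set0 by apply/set0P/AB/set0P.
rewrite lee_wpmul2l//.
  by rewrite lee_fin divr_ge0 ?ball_volume_ge0 ?exprn_ge0.
by apply: expe_homo => //; exact: diameter_ge0.
Qed.

(** The image of a cover is a cover by sets that are no larger. *)
Lemma hausdorff_contraction (f : E -> E) A :
  (forall p q, (edist (f p) (f q) <= edist p q)%R) ->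
  hausdorff k (f @` A) <= hausdorff k A.
Proof.
move=> fC; apply: ge_ereal_sup => _ [e e0 <-].
apply: (@le_trans _ _ (hausdorff_pre k e A)); last first.
  by apply: ereal_sup_ubound; exists e.
apply: le_ereal_inf_tmp => _ [C [dC AC] <-].
apply: (@le_trans _ _ (\sum_(i <oo) hausdorff_gauge k (f @` C i))).
  apply: ereal_inf_lbound; exists (fun i => f @` C i) => //; split.
    by move=> i; apply: le_trans (dC i); exact: diameter_image.
  by rewrite -image_bigcup; exact: image_subset.
apply: lee_nneseries => [i _ _|i _]; first exact: hausdorff_gauge_ge0.
apply: le_hausdorff_gauge; last exact: diameter_image.
by move=> [_ [x Cx _]]; exists x.
Qed.

Lemma hausdorff_pre_anti e e' A : (e <= e')%R ->
  hausdorff_pre k e' A <= hausdorff_pre k e A.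
Proof.
move=> ee'; apply/ereal_inf_le_tmp => _ [C [dC AC] <-]; exists C => //.
by split => // i; apply: le_trans (dC i) _; rewrite lee_fin.
Qed.

(** A set of diameter less than [r] cannot meet both [A] and [B], so a
    sufficiently fine cover of the union splits into covers of the two parts. *)
Lemma hausdorff_separated (r : R) A B : (0 < r)%R ->
  (forall p q, A p -> B q -> (r <= edist p q)%R) ->
  hausdorff k A + hausdorff k B <= hausdorff k (A `|` B).
Proof.
move=> r0 sep; set M := hausdorff k (A `|` B).
have pre e : (0 < e)%R -> hausdorff_pre k e A + hausdorff_pre k e B <= M.
  move=> e0; pose d : R := Num.min e (r / 2)%R.
  have d0 : (0 < d)%R by rewrite lt_min e0 divr_gt0.
  have dr : (d < r)%R by rewrite gt_min orbC ltr_pdivrMr// ltr_pMr ?ltr1n.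
  apply: (@le_trans _ _ (hausdorff_pre k d A + hausdorff_pre k d B)).
    by apply: leeD; apply: hausdorff_pre_anti; rewrite ge_min lexx.
  apply: (@le_trans _ _ (hausdorff_pre k d (A `|` B))); last first.
    by apply: ereal_sup_ubound; exists d.
  apply: le_ereal_inf_tmp => _ [C [dC ABC] <-].
  have cov D : D `<=` A `|` B -> hausdorff_pre k d D <=
      \sum_(i <oo) hausdorff_gauge k (C i `&` D).
    move=> DAB; apply: ereal_inf_lbound; exists (fun i => C i `&` D) => //; split.
      by move=> i; apply: le_trans (dC i); apply: le_diameter => x [].
    by move=> x Dx; have [i _ Cx] := ABC _ (DAB _ Dx); exists i.
  apply: le_trans (leeD (cov A _) (cov B _)) _; [exact: subsetUl|exact: subsetUr|].
  rewrite -nneseriesD; [|by move=> *; exact: hausdorff_gauge_ge0..].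
  apply: lee_nneseries => [i _ _|i _].
    by apply: adde_ge0; exact: hausdorff_gauge_ge0.
  have gle D : hausdorff_gauge k (C i `&` D) <= hausdorff_gauge k (C i).
    apply: le_hausdorff_gauge; first by move=> [x []]; exists x.
    by apply: le_diameter => x [].
  have [->|/set0P[p [Cp Ap]]] := eqVneq (C i `&` A) set0.
    by rewrite hausdorff_gauge0 add0e.
  have [->|/set0P[q [Cq Bq]]] := eqVneq (C i `&` B) set0.
    by rewrite hausdorff_gauge0 adde0.
  have : ((edist p q)%:E <= d%:E).
    by apply: le_trans (dC i); apply: ereal_sup_ubound; exists (p, q).
  by rewrite lee_fin => /(le_trans (sep _ _ Ap Bq)); rewrite leNgt dr.
have [Moo|] := boolP (M < +oo); last first.
  by rewrite -leNgt leye_eq => /eqP ->; rewrite leey.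
have fin D : D `<=` A `|` B -> hausdorff k D \is a fin_num.
  move=> DAB; rewrite ge0_fin_numE ?hausdorff_ge0//.
  by apply: le_lt_trans Moo; exact: le_hausdorff.
have fA := fin A (@subsetUl _ A B); have fB := fin B (@subsetUr _ A B).
have fpre e D : D `<=` A `|` B -> (0 < e)%R -> hausdorff_pre k e D \is a fin_num.
  move=> DAB e0; rewrite ge0_fin_numE ?hausdorff_pre_ge0//.
  apply: (@le_lt_trans _ _ (hausdorff k D)).
    by apply: ereal_sup_ubound; exists e.
  by rewrite -ge0_fin_numE ?hausdorff_ge0// fin.
rewrite -leeBrDr//; apply: ge_ereal_sup => _ [e e0 <-].
rewrite leeBrDr// addeC -leeBrDr; last exact: fpre.
apply: ge_ereal_sup => _ [e' e'0 <-].
rewrite leeBrDr; last exact: fpre.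
apply: le_trans (pre (Num.min e e') _); last by rewrite lt_min e0 e'0.
by rewrite addeC; apply: leeD; apply: hausdorff_pre_anti; rewrite ge_min lexx ?orbT.
Qed.

Lemma hausdorff_sublevel (f : E -> R) s :
  (forall p q, (`|f p - f q| <= edist p q)%R) ->
  (hausdorff k).-caratheodory [set p | (f p <= s)%R].
Proof.
move=> fL; apply: caratheodory_sublevel => A B u v uv Au Bv.
apply: (@hausdorff_separated (v - u)); first by rewrite subr_gt0.
move=> p q /Au/= pu /Bv/= qv.
apply: le_trans (fL p q); rewrite distrC.
apply: le_trans (ler_norm _); lra.
Qed.

End hausdorff_theory.

(** * Borel sets of R^m x R *)

Section borel.
Context {R : realType}.

Lemma measurable_ball_prod m (p : 'rV[R]_m * R) (e : R) :
  measurable (ball p e : set ('rV[R]_m * measurableTypeR R)).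
Proof.
have [e0|e0] := ltP 0 e; last first.
  rewrite (_ : ball p e = set0) //; apply/seteqP; split => // q [_ /=].
  by rewrite -ball_normE/= => /(le_lt_trans (normr_ge0 _)); rewrite ltNge e0.
have mball (r : R) : measurable (ball r e : set (measurableTypeR R)).
  by apply: open_measurable; exact: ball_open.
rewrite (_ : ball p e =
    [set v : 'rV[R]_m | forall i, ball (p.1 ord0 i) e (v ord0 i)] `*` ball p.2 e).
  apply: (@measurableX _ _ 'rV[R]_m (measurableTypeR R)); last exact: mball.
  rewrite (_ : mkset _ = \bigcap_(i in [set: 'I_m])
      ((fun v : 'rV[R]_m => (v ord0 i : measurableTypeR R)) @^-1` ball (p.1 ord0 i) e)).
  apply: fin_bigcap_measurable; first exact: finite_finset.
    move=> i _; rewrite -[X in measurable X]setTI.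
    exact: measurable_rV_coord (mball _).
  by apply/seteqP; split => v /= h i; [move=> _|]; exact: h.
apply/seteqP; split => q [/= h1 h2]; split => //=.
  by move=> i; apply h1.
by split => // j i; rewrite ord1.
Qed.

(** The sigma-algebra on row vectors is generated by the coordinates; open sets
    belong to the product sigma-algebra as countable unions of rational boxes. *)
Lemma open_measurable_prod m (A : set ('rV[R]_m * R)) :
  open A -> measurable (A : set ('rV[R]_m * measurableTypeR R)).
Proof.
move=> oA; pose I := ('rV[rat]_m * rat * nat)%type.
pose q (i : I) : 'rV[R]_m * R := (map_mx ratr i.1.1, ratr i.1.2).
pose B (i : I) : set ('rV[R]_m * measurableTypeR R) := ball (q i) i.2.+1%:R^-1.
rewrite (_ : A = \bigcup_i (if `[< B i `<=` A >] then B i else set0)).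
  apply: countable_bigcupT_measurable; first exact: countableP.
  by move=> i; case: ifP => // _; exact: measurable_ball_prod.
apply/seteqP; split => [z Az|z [i _]]; last by case: ifPn => // /asboolP; apply.
have [e /= e0 zA] : nbhs_ball z A.
  by apply/(nbhs_ballP z); apply: open_nbhs_nbhs.
have [k hk] : exists k, k.+1%:R^-1 < e / 2.
  by have [|k] := @ltr_add_invr R 0 (e / 2); [rewrite divr_gt0|rewrite add0r; exists k].
set d : R := k.+1%:R^-1; have d0 : 0 < d by rewrite invr_gt0.
have rat_near (x : R) : exists r : rat, ball (ratr r : R) d x.
  have /rat_in_itvoo[r] : x < x + d by rewrite ltrDl.
  rewrite in_itv/= => /andP[xr rx]; exists r.
  by rewrite -ball_normE/= ltr_norml; apply/andP; split; lra.
have /fin_all_exists[f hf] (j : 'I_m) : exists r : rat, ball (ratr r : R) d (z.1 ord0 j).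
  exact: rat_near.
have [r hr] := rat_near z.2.
pose i : I := (\row_j f j, r, k).
have iz : B i z.
  split => //=; split => // j0 j; rewrite ord1 !mxE; exact: hf.
exists i => //; case: ifPn => // /asboolP[] w iw; apply: zA.
apply: (@le_ball _ _ z (d + d)); first by rewrite -/d in hk; lra.
by apply: ball_triangle iw; exact: ball_sym.
Qed.

Lemma closed_measurable_prod m (A : set ('rV[R]_m * R)) :
  closed A -> measurable (A : set ('rV[R]_m * measurableTypeR R)).
Proof.
by move=> /closed_openC/open_measurable_prod/measurableC; rewrite setCK.
Qed.

Lemma open_measurable_rV m (A : set 'rV[R]_m) : open A -> measurable A.
Proof.
move=> oA; have : open (fst @^-1` A : set ('rV[R]_m * R)).
  by apply: open_comp => // z _; exact: cvg_fst.
move=> /open_measurable_prod mA.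
have mpair : measurable_fun setT (fun x : 'rV[R]_m => (x, 0 : measurableTypeR R)).
  by apply: measurable_fun_pair => //; exact: measurable_cst.
by have := mpair measurableT _ mA; rewrite setTI.
Qed.

Lemma continuous_measurable_rV m (f : 'rV[R]_m -> R) :
  continuous f -> measurable_fun setT (f : 'rV[R]_m -> measurableTypeR R).
Proof.
move=> /continuousP cf; apply: (measurability _ (RGenOpens.measurableE R)).
move=> _ [_ [a [b ->] <-]]; rewrite setTI; apply: open_measurable_rV.
exact/cf/interval_open.
Qed.

(** The coordinates generate the Borel sets, and they are 1-Lipschitz for the
    Euclidean distance, so [hausdorff_sublevel] applies to them. *)
Lemma measurable_id_hausdorff m k :
  measurable_fun setT
    (id : caratheodory_type (@hausdorff R m k) -> 'rV[R]_m * measurableTypeR R).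
Proof.
have lip (f : 'rV[R]_m * R -> R) : (forall p q, `|f p - f q| <= edist p q) ->
    measurable_fun setT
      (f : caratheodory_type (@hausdorff R m k) -> measurableTypeR R).
  move=> fL; apply: (measurability _ (RGenOInfty.measurableE R)).
  move=> _ [_ [s ->] <-]; rewrite setTI.
  rewrite (_ : _ @^-1` _ = ~` [set p | f p <= s]); last first.
    apply/seteqP; split => p /=; rewrite in_itv/= andbT => h.
      by apply/negP; rewrite -ltNge.
    by rewrite ltNge; exact/negP.
  by apply: measurableC; exact: hausdorff_sublevel.
pose c1 : caratheodory_type (@hausdorff R m k) -> 'rV[R]_m := fst.
pose c2 : caratheodory_type (@hausdorff R m k) -> measurableTypeR R := snd.
have -> : id = (fun z => (c1 z, c2 z)) by apply/funext => -[].
apply: measurable_fun_pair.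
  apply: measurable_fun_rVP => i; apply: (lip (fun p => p.1 ord0 i)) => p q.
  exact: edist_coord.
by apply: (lip snd) => p q; exact: edist_snd.
Qed.

End borel.

(** * Lebesgue measure of R^n and its uniqueness *)

Section lebesgue_rV_theory.
Context {R : realType}.
Local Open Scope ereal_scope.
Local Notation leb := (@lebesgue_measure R).

Lemma lebesgue_measure_shift (r : R) (A : set (measurableTypeR R)) :
  measurable A ->
  pushforward leb ((fun x => x + r)%R : measurableTypeR R -> measurableTypeR R) A
    = leb A.
Proof.
have mshift : measurable_fun setT
    ((fun x => x + r)%R : measurableTypeR R -> measurableTypeR R).
  by apply: measurable_funD => //; exact: measurable_id.
move=> mA; apply/esym/(@lebesgue_measure_unique _
  (measure_function_pushforward__canonical__measure_function_Measure leb mshift)) => //.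
move=> _ [[a b]] _ <- /=; rewrite /pushforward.
rewrite (_ : _ @^-1` _ = `](a - r)%R, (b - r)%R]%classic); last first.
  by apply/seteqP; split => x /=; rewrite !in_itv/= ltrBlDr lerBrDr.
rewrite !lebesgue_measure_itv/= !lte_fin ltrD2r.
by case: ifPn => // _; rewrite -!EFinB; congr (_%:E); ring.
Qed.

Definition rV_shift n (v x : 'rV[R]_n) : 'rV[R]_n := (x + v)%R.

Lemma measurable_rV_add d (T : measurableType d) n (f g : T -> 'rV[R]_n) :
  measurable_fun setT f -> measurable_fun setT g ->
  measurable_fun setT (fun x => f x + g x)%R.
Proof.
move=> mf mg; apply: measurable_fun_rVP => i.
under eq_fun do rewrite mxE.
by apply: measurable_funD;
  [apply: (measurableT_comp (measurable_rV_coord i) mf)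
  |apply: (measurableT_comp (measurable_rV_coord i) mg)].
Qed.

Lemma measurable_rV_opp d (T : measurableType d) n (f : T -> 'rV[R]_n) :
  measurable_fun setT f -> measurable_fun setT (fun x => - f x)%R.
Proof.
move=> mf; apply: measurable_fun_rVP => i.
under eq_fun do rewrite mxE.
apply: (measurableT_comp (@oppr_measurable R setT)).
exact: (measurableT_comp (measurable_rV_coord i) mf).
Qed.

Lemma measurable_preimage d d' (T : measurableType d) (T' : measurableType d')
    (f : T -> T') (A : set T') :
  measurable_fun setT f -> measurable A -> measurable (f @^-1` A).
Proof. by move=> mf mA; rewrite -[X in measurable X]setTI; exact: mf. Qed.

(** By induction on the dimension: translating by [v] translates each section by
    the tail of [v], and the sections among themselves by its head. *)
Lemma lebesgue_rV_shift n (v : 'rV[R]_n) A : measurable A ->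
  lebesgue_rV n (rV_shift v @^-1` A) = lebesgue_rV n A.
Proof.
elim: n v A => [|n IH] v A mA.
  rewrite (_ : rV_shift v @^-1` A = A)//; apply/seteqP; split => x;
    by rewrite /= (_ : rV_shift v x = x)//; apply/rowP => -[].
pose w := (\row_j v ord0 (lift ord0 j))%R : 'rV[R]_n.
set B := @rV_cons R n @^-1` A.
have mB : measurable B by exact: measurable_preimage (@measurable_rV_cons R n) mA.
change ((leb \x lebesgue_rV n) (@rV_cons R n @^-1` (rV_shift v @^-1` A)) =
  (leb \x lebesgue_rV n) B).
pose s : measurableTypeR R -> measurableTypeR R := (fun x => x + v ord0 ord0)%R.
have ms : measurable_fun setT s by apply: measurable_funD => //; exact: measurable_id.
rewrite /product_measure1.
transitivity (\int[leb]_x ((lebesgue_rV n \o xsection B) \o s) x).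
  apply: eq_integral => x _ /=.
  rewrite -[RHS](IH w); last exact: measurable_xsection.
  congr (lebesgue_rV n _); apply/seteqP; split => y /=;
    rewrite /xsection/= !inE /B/=.
    rewrite (_ : rV_shift v _ = rV_cons (s x, rV_shift w y))//.
    apply/rowP => i; rewrite !mxE; case: unliftP => [j ->|->]/=; by rewrite ?mxE.
  rewrite (_ : rV_shift v _ = rV_cons (s x, rV_shift w y))//.
  apply/rowP => i; rewrite !mxE; case: unliftP => [j ->|->]/=; by rewrite ?mxE.
rewrite -[LHS](@ge0_integral_pushforward _ _ _ _ _ _ ms leb setT)//; last first.
  exact: measurable_fun_xsection.
by apply: eq_measure_integral => C mC _; exact: lebesgue_measure_shift.
Qed.

Definition rV_box n (M : R) : set 'rV[R]_n :=
  [set v | forall i, (`|v ord0 i| <= M)%R].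

Lemma measurable_rV_box n M : measurable (@rV_box n M).
Proof.
rewrite (_ : rV_box M = \bigcap_(i in [set: 'I_n])
    ((fun v : 'rV[R]_n => (v ord0 i : measurableTypeR R)) @^-1` `[(- M)%R, M])).
  apply: fin_bigcap_measurable; first exact: finite_finset.
  move=> i _; apply: measurable_preimage (measurable_rV_coord i) _.
  exact: measurable_itv.
apply/seteqP; split => v /= h i; first by move=> _ /=; rewrite in_itv/= -ler_norml.
by have := h i Logic.I; rewrite /= in_itv/= -ler_norml.
Qed.

Lemma lebesgue_rV_box n (M : R) : (0 <= M)%R ->
  lebesgue_rV n (rV_box M) = ((M + M) ^+ n)%:E.
Proof.
move=> M0; elim: n => [|n IH].
  rewrite /= diracE mem_set//; by case.
change ((leb \x lebesgue_rV n) (@rV_cons R n @^-1` (rV_box M)) = ((M + M) ^+ n.+1)%:E).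
rewrite (_ : _ @^-1` _ = `[(- M)%R, M]%classic `*` rV_box M); last first.
  apply/seteqP; split => -[x v] /=; rewrite /rV_box/= in_itv/= -ler_norml => h.
    split; first by have := h ord0; rewrite mxE unlift_none.
    by move=> i; have := h (lift ord0 i); rewrite mxE liftK.
  by move=> i; rewrite mxE; case: unliftP => [j _|_] /=; [apply: h.2|exact: h.1].
rewrite product_measure1E//; last exact: measurable_rV_box.
rewrite exprS EFinM; congr (_ * _); last exact: IH.
have := @lebesgue_measure_itv R `[(- M)%R, M] => /= ->.
rewrite lte_fin; case: ltP => h; first by rewrite -EFinB opprK.
by congr (_%:E); lra.
Qed.

(** The classical proof that an invariant measure is unique up to a factor.
    Under [nu \x mu] the set [A x /\ B (x + y)] has measure [nu A * mu B], as is
    seen by integrating in [y] first.  Translating [x] by [- y] turns it, section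
    by section, into [B x /\ A (x - y)], of measure [nu B * mu (- A)]. *)
Lemma shift_invariant_measure_unique n
    (nu mu : {sigma_finite_measure set 'rV[R]_n -> \bar R})
    (A B : set 'rV[R]_n) :
  (forall v C, measurable C -> nu (rV_shift v @^-1` C) = nu C) ->
  (forall v C, measurable C -> mu (rV_shift v @^-1` C) = mu C) ->
  measurable A -> measurable B ->
  nu A * mu B = nu B * mu (-%R @^-1` A).
Proof.
move=> nuI muI mA mB.
have m12 (X : set ('rV[R]_n * 'rV[R]_n)) : measurable X -> (nu \x mu) X = (nu \x^ mu) X.
  by move=> mX; apply: product_measure_unique => // *; exact: product_measure2E.
have mopp : measurable_fun setT (-%R : 'rV[R]_n -> 'rV[R]_n).
  by apply: measurable_rV_opp; exact: measurable_id.
have mAN : measurable (-%R @^-1` A : set 'rV[R]_n) by exact: measurable_preimage.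
pose C := [set p : 'rV[R]_n * 'rV[R]_n | A p.1 /\ B (p.1 + p.2)%R].
pose D := [set p : 'rV[R]_n * 'rV[R]_n | B p.1 /\ A (p.1 - p.2)%R].
have mC : measurable C.
  apply: measurableI; first exact: measurable_preimage.
  suff : measurable ((fun p : 'rV[R]_n * 'rV[R]_n => p.1 + p.2)%R @^-1` B) by [].
  by apply: measurable_preimage mB; exact: measurable_rV_add.
have mD : measurable D.
  apply: measurableI; first exact: measurable_preimage.
  suff : measurable ((fun p : 'rV[R]_n * 'rV[R]_n => p.1 - p.2)%R @^-1` A) by [].
  apply: measurable_preimage mA.
  by apply: measurable_rV_add => //; exact: measurable_rV_opp.
have val (X Y : set 'rV[R]_n) (Z : set ('rV[R]_n * 'rV[R]_n)) :
    measurable X -> measurable Z ->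
    (forall x, X x -> mu (xsection Z x) = mu Y) ->
    (forall x, ~ X x -> xsection Z x = set0) ->
    (nu \x mu) Z = nu X * mu Y.
  move=> mX mZ Z1 Z0; rewrite /product_measure1.
  rewrite (eq_integral (fun x => (\1_X x)%:E * mu Y)); last first.
    move=> x _; rewrite indicE /=; case: (boolP (x \in X));
      rewrite ?inE ?notin_setE => Xx.
      by rewrite mul1e Z1.
    by rewrite mul0e Z0// measure0.
  by rewrite ge0_integralZr ?integral_indic ?setIT//; exact: measurableT_comp.
rewrite -(val A B C)//; last 2 first.
- move=> x Ax; rewrite -(muI x B)//; congr (mu _); apply/seteqP.
  by split => y; rewrite xsectionE /C /= /rV_shift addrC; [case|].
- by move=> x Ax; apply/seteqP; split => // y; rewrite xsectionE => -[].
rewrite -(val B (-%R @^-1` A) D)//; last 2 first.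
- move=> x Bx; rewrite -(muI (- x)%R (-%R @^-1` A))//; congr (mu _); apply/seteqP.
  by split => y; rewrite xsectionE /D /= /rV_shift opprB; [case|].
- by move=> x Bx; apply/seteqP; split => // y; rewrite xsectionE => -[].
rewrite !m12// /product_measure2; apply: eq_integral => y _ /=.
rewrite -(nuI y (ysection D y)); last exact: measurable_ysection.
congr (nu _); apply/seteqP; split => x;
  rewrite /ysection /= !inE /C /D /= /rV_shift addrK; tauto.
Qed.

End lebesgue_rV_theory.

(** * Hausdorff area of graphs over R^m *)

Section graph_area.
Context {R : realType} {m : nat}.
Local Open Scope ereal_scope.
Local Notation E := ('rV[R]_m * R)%type.
Local Notation C := (caratheodory_type (@hausdorff R m m)).

Let outer : {outer_measure set E -> \bar R} := @hausdorff R m m.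

Definition hausdorff_measure : {measure set C -> \bar R} := outer.

Local Notation H := hausdorff_measure.

Lemma measurable_hausdorff (A : set ('rV[R]_m * measurableTypeR R)) :
  measurable A -> measurable (A : set C).
Proof. by move=> mA; exact (measurable_preimage (@measurable_id_hausdorff R m m) mA). Qed.

Definition graph (T : 'rV[R]_m -> R) : set E := [set z | z.2 = T z.1].

Lemma measurable_base : measurable_fun setT (fst : C -> 'rV[R]_m).
Proof.
exact: (measurableT_comp (@measurable_fst _ _ 'rV[R]_m (measurableTypeR R))
  (@measurable_id_hausdorff R m m)).
Qed.

Lemma measurable_height : measurable_fun setT (snd : C -> measurableTypeR R).
Proof.
exact: (measurableT_comp (@measurable_snd _ _ 'rV[R]_m (measurableTypeR R))
  (@measurable_id_hausdorff R m m)).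
Qed.

Lemma measurable_graph (T : 'rV[R]_m -> measurableTypeR R) : measurable_fun setT T ->
  measurable (graph T : set C).
Proof.
move=> mT; pose f := (fun z : C => (snd z - T (fst z))%R : measurableTypeR R).
have mf : measurable_fun setT f.
  apply: measurable_funB; first exact: measurable_height.
  exact: (measurableT_comp mT measurable_base).
rewrite (_ : graph T = f @^-1` [set 0%R]).
  exact (measurable_preimage mf (measurable_set1 _)).
apply/seteqP; split => z; rewrite /graph /f/=; first by move=> ->; rewrite subrr.
by move=> /eqP; rewrite subr_eq0 => /eqP.
Qed.

(** The area of the part of the graph of [T] above a subset of the base, as a
    measure on the base. *)
Definition graph_area (T : 'rV[R]_m -> measurableTypeR R) (mT : measurable_fun setT T) :
    {measure set 'rV[R]_m -> \bar R} :=
  measure_function_pushforward__canonical__measure_function_Measure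
    (mrestr H (measurable_graph mT) : {measure set C -> \bar R}) measurable_base.

Lemma graph_areaE T (mT : measurable_fun setT T) B :
  graph_area mT B = H (fst @^-1` B `&` graph T).
Proof. by []. Qed.

Lemma integral_graph_area T (mT : measurable_fun setT T) (P : set 'rV[R]_m)
    (g : 'rV[R]_m -> \bar R) :
  measurable P -> measurable_fun setT g -> (forall x, 0 <= g x) ->
  \int[graph_area mT]_(x in P) g x = \int[H]_(z in fst @^-1` P `&` graph T) g z.1.
Proof.
move=> mP mg g0.
have mG := measurable_graph mT.
have mFP : measurable (fst @^-1` P : set C) by exact: measurable_preimage measurable_base mP.
have mgf : measurable_fun setT (g \o (fst : C -> 'rV[R]_m)).
  exact: measurableT_comp mg measurable_base.
pose r : {measure set C -> \bar R} := mrestr H (measurable_graph mT).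
transitivity (\int[r]_(z in fst @^-1` P) (g \o (fst : C -> 'rV[R]_m)) z).
  apply: (@ge0_integral_pushforward _ _ C 'rV[R]_m R fst measurable_base r P g) => //.
  exact: measurable_funTS.
transitivity (\int[r]_(z in fst @^-1` P `&` graph T) (g \o (fst : C -> 'rV[R]_m)) z).
  rewrite -[in RHS]setDD; apply: ge0_negligible_integral => //.
  - exact: measurableD.
  - exact: measurable_funTS.
  - by move=> z _; exact: g0.
  - change (H ((fst @^-1` P `\` graph T) `&` graph T) = 0).
    by rewrite setDE -setIA setICl setI0 measure0.
apply: eq_measure_integral => A mA AD.
change (H (A `&` graph T) = H A).
by congr (H _); apply/setIidPl => z /AD[].
Qed.

Let mcst (c : R) : measurable_fun [set: 'rV[R]_m] (cst c : 'rV[R]_m -> measurableTypeR R).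
Proof. exact: measurable_cst. Qed.

Definition flat_area (c : R) : set 'rV[R]_m -> \bar R := graph_area (mcst c).

HB.instance Definition _ c := Measure.copy (flat_area c) (graph_area (mcst c)).

(** The flat piece above [B] is the image of the graph above [B] under the
    projection, which is a contraction. *)
Lemma flat_area_le_graph_area c T (mT : measurable_fun setT T) B :
  measurable B -> flat_area c B <= graph_area mT B.
Proof.
move=> mB; rewrite graph_areaE.
apply: le_trans (@hausdorff_contraction _ _ m (fun z => (z.1, c)) _ _); last exact: edist_flat.
by apply: le_hausdorff => -[x t] [/= Bx]; rewrite /graph/= => ->; exists (x, T x).
Qed.

Lemma flat_area_shift c v B : measurable B ->
  flat_area c (rV_shift v @^-1` B) = flat_area c B.
Proof.
suff le w D : flat_area c (rV_shift w @^-1` D) <= flat_area c D.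
  move=> mB; apply/eqP; rewrite eq_le le/=.
  rewrite {1}(_ : B = rV_shift (- v) @^-1` (rV_shift v @^-1` B)) ?le//.
  by apply/seteqP; split => x; rewrite /= /rV_shift subrK.
apply: le_trans (@hausdorff_contraction _ _ m (fun z => (z.1 - w, z.2)%R) _ _).
  apply: le_hausdorff => -[x t] [/= Bx]; rewrite /graph/= => ->; exists (x + w, c)%R => //=.
  by rewrite addrK.
by move=> p q; rewrite edist_shift.
Qed.

End graph_area.

Section flat_area_finite.
Context {R : realType} {m : nat}.
Local Open Scope ereal_scope.
Local Notation E := ('rV[R]_m * R)%type.

Lemma ex_subinterval N (s x : R) : (0 < N)%N -> (0 <= x <= N%:R * s)%R ->
  exists j : 'I_N, (j%:R * s <= x <= j%:R * s + s)%R.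
Proof.
case: N => // N _; elim: N => [|N IH] /andP[x0 xN].
  by exists ord0; rewrite mul0r add0r x0; rewrite mul1r in xN.
have [xN'|xN'] := leP x (N.+1%:R * s)%R.
  by have [|j hj] := IH; [rewrite x0|exists (widen_ord (leqnSn _) j)].
exists ord_max => /=; rewrite (ltW xN')/=.
by rewrite -[X in (_ <= _ + X)%R]mul1r -mulrDl natr1.
Qed.

(** Subdivide the cube into [N ^ m] cubes of side [s = 2M / N]: the gauges of the
    pieces add up to a bound that does not depend on [N]. *)
Lemma hausdorff_pre_cube c (M : R) N (e : R) :
  (0 <= M)%R -> (0 < N)%N ->
  (Num.sqrt m%:R * ((M + M) / N%:R) <= e)%R ->
  hausdorff_pre m e [set z : E | rV_box M z.1 /\ z.2 = c] <=
    (ball_volume R m / 2 ^+ m * (Num.sqrt m%:R * (M + M)) ^+ m)%:E.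
Proof.
move=> M0 N0 Ne; set s : R := ((M + M) / N%:R)%R.
have NR : (0 < N%:R :> R)%R by rewrite ltr0n.
have s0 : (0 <= s)%R by rewrite divr_ge0// ?addr_ge0// ltW.
pose I := {ffun 'I_m -> 'I_N}.
pose Q (f : I) : set E := [set z : E | z.2 = c /\
  forall i, ((f i)%:R * s <= z.1 ord0 i + M <= (f i)%:R * s + s)%R].
pose K (i : nat) : set E :=
  if insub i is Some j then Q (enum_val (j : 'I_#|I|)) else set0.
set G := (ball_volume R m / 2 ^+ m * (Num.sqrt m%:R * s) ^+ m)%R.
have b0 : (0 <= ball_volume R m / 2 ^+ m)%R by rewrite divr_ge0 ?ball_volume_ge0 ?exprn_ge0.
have G0 : (0 <= G)%R by rewrite mulr_ge0// exprn_ge0// mulr_ge0 ?sqrtr_ge0.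
have dQ f : diameter (Q f) <= (Num.sqrt m%:R * s)%:E.
  apply: ge_ereal_sup => _ [[p q] [/= [p2 hp] [q2 hq]] <-]; rewrite lee_fin.
  rewrite -[s in leRHS]ger0_norm// -sqrtr_sqr -sqrtrM ?ler0n// ler_sqrt; last first.
    exact: mulr_ge0 (ler0n _ _) (sqr_ge0 _).
  rewrite /= p2 q2 subrr expr0n/= addr0.
  rewrite -[m in leRHS]card_ord mulrC mulr_natr -sumr_const; apply: ler_sum => i _.
  rewrite -[leLHS]real_normK ?num_real// ler_pXn2r ?nnegrE// ler_norml.
  have /andP[] := hp i; have /andP[] := hq i; move=> *; apply/andP; split; lra.
have gQ f : hausdorff_gauge m (Q f) <= G%:E.
  rewrite /hausdorff_gauge; case: ifPn => [_|/diameter_ge0 d0]; first by rewrite lee_fin.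
  rewrite /G [leRHS]EFinM lee_wpmul2l ?lee_fin// EFin_expe; exact: expe_homo.
apply: (@le_trans _ _ (\sum_(i <oo) hausdorff_gauge m (K i))).
  apply: ereal_inf_lbound; exists K => //; split.
    move=> i; rewrite /K; case: insubP => [j _ _|_].
      by apply: le_trans (dQ _) _; rewrite lee_fin.
    by rewrite /diameter set0X image_set0 ereal_sup0 leNye.
  move=> z [zM zc].
  have /fin_all_exists[f hf] i :
      exists j : 'I_N, (j%:R * s <= z.1 ord0 i + M <= j%:R * s + s)%R.
    apply: ex_subinterval => //; have := zM i.
    rewrite /s mulrC divfK ?gt_eqF// ler_norml => /andP[? ?].
    by apply/andP; split; lra.
  exists (enum_rank ([ffun i => f i] : I)) => //.
  rewrite /K; case: insubP => [j _ /val_inj ->|]; last by rewrite ltn_ord.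
  by rewrite enum_rankK; split => // i; rewrite ffunE.
rewrite (nneseries_split 0 #|I|); last by move=> *; exact: hausdorff_gauge_ge0.
rewrite [X in _ + X]eseries0 ?adde0; last first.
  move=> i; rewrite add0n => Ii _; rewrite /K insubF ?hausdorff_gauge0//.
  by rewrite ltnNge Ii.
rewrite add0n; apply: (@le_trans _ _ (\sum_(0 <= k < #|I|) G%:E)).
  apply: lee_sum => i _; rewrite /K; case: insubP => [j _ _|_]; first exact: gQ.
  by rewrite hausdorff_gauge0 lee_fin.
rewrite sumEFin lee_fin big_mkord sumr_const card_ord card_ffun !card_ord.
rewrite /G -[leLHS]mulr_natr -[leLHS]mulrA ler_wpM2l// natrX -exprMn.
by rewrite /s -mulrA divfK ?gt_eqF.
Qed.

Lemma flat_area_box_fin c (M : R) : (0 <= M)%R -> flat_area c (@rV_box R m M) < +oo.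
Proof.
move=> M0; set B := (ball_volume R m / 2 ^+ m * (Num.sqrt m%:R * (M + M)) ^+ m)%R.
apply: (@le_lt_trans _ _ B%:E); last exact: ltry.
apply: ge_ereal_sup => _ [e e0 <-].
have [k hk] := @ltr_add_invr R 0 (e / (Num.sqrt m%:R * (M + M) + 1))%R
  ltac:(by rewrite divr_gt0// ltr_pwDr// mulr_ge0 ?sqrtr_ge0 ?addr_ge0).
apply: (@hausdorff_pre_cube c M k.+1) => //.
have h0 : (0 <= Num.sqrt m%:R * (M + M) :> R)%R by rewrite mulr_ge0 ?sqrtr_ge0 ?addr_ge0.
move: hk; rewrite add0r ltr_pdivlMr; last by rewrite ltr_pwDr.
rewrite mulrA => hk; apply: le_trans (ltW hk).
by rewrite mulrC ler_wpM2l// lerDl.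
Qed.

Let flat_area_sigma_finite c : sigma_finite setT (@flat_area R m c).
Proof.
exists (fun k : nat => rV_box k%:R).
  apply/seteqP; split => // v _; exists (\max_(i < m) (Num.truncn `|v ord0 i|%R).+1)%N => // i.
  apply: (@le_trans _ _ (Num.truncn `|v ord0 i|%R).+1%:R); first exact/ltW/truncnS_gt.
  by rewrite ler_nat (leq_bigmax_cond (F := fun i => (Num.truncn `|v ord0 i|%R).+1)).
by move=> k; split; [exact: measurable_rV_box|exact: flat_area_box_fin].
Qed.

HB.instance Definition _ c := Measure_isSigmaFinite.Build _ _ _ (@flat_area R m c)
  (flat_area_sigma_finite c).

(** Uniqueness of invariant measures, applied with a symmetric cube as test
    set. *)
Lemma flat_area_lebesgue c : exists l : {nonneg R},
  forall B : set 'rV[R]_m, measurable B -> flat_area c B = l%:num%:E * lebesgue_rV m B.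
Proof.
pose A : set 'rV[R]_m := rV_box 1.
have A1 : lebesgue_rV m A = (2 ^+ m)%:E by rewrite lebesgue_rV_box.
have mA : measurable A by exact: measurable_rV_box.
have AN : -%R @^-1` A = A.
  by apply/seteqP; split => v /= h i; have := h i; rewrite mxE normrN.
have fA : flat_area c A \is a fin_num by rewrite ge0_fin_numE ?measure_ge0// flat_area_box_fin.
have l0 : (0 <= fine (flat_area c A) / 2 ^+ m)%R.
  by rewrite divr_ge0 ?exprn_ge0// fine_ge0.
exists (NngNum l0) => B mB /=.
have := @shift_invariant_measure_unique R m (lebesgue_rV m) (flat_area c) A B
  (@lebesgue_rV_shift R m) (@flat_area_shift R m c) mA mB.
rewrite AN A1 => h.
have p2 : (2 ^+ m != 0 :> R)%R by rewrite expf_neq0.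
rewrite EFinM fineK// muleAC muleC [X in _ * X]muleC -h muleA -EFinM mulVf//.
by rewrite mul1e.
Qed.

End flat_area_finite.

(** * Product weights: areas of graphs and volumes slice by slice *)

Section product_weight.
Context {R : realType} {m : nat}.
Local Open Scope ereal_scope.
Local Notation E := ('rV[R]_m * R)%type.
Local Notation leb := (@lebesgue_measure R).
Local Notation L := (@lebesgue_rV R m).
Variables (e : 'rV[R]_m -> measurableTypeR R) (w : measurableTypeR R -> measurableTypeR R).
Hypotheses (me : measurable_fun setT e) (mw : measurable_fun setT w).
Hypotheses (e0 : forall x, (0 <= e x)%R) (w0 : forall t, (0 <= w t)%R).

Definition weight (z : E) : R := (e z.1 * w z.2)%R.

Definition vertical_slice (A : set E) (x : 'rV[R]_m) : set (measurableTypeR R) :=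
  [set t | A (x, t)].

Definition graph_base (A : set E) (T : 'rV[R]_m -> R) : set 'rV[R]_m := [set x | A (x, T x)].

Definition slice_mass (A : set E) (x : 'rV[R]_m) : \bar R :=
  \int[leb]_(t in vertical_slice A x) (w t)%:E.

Lemma measurable_weight :
  measurable_fun setT (weight : 'rV[R]_m * measurableTypeR R -> measurableTypeR R).
Proof.
by apply: measurable_funM; [exact: (measurableT_comp me (@measurable_fst _ _ _ _))
  |exact: (measurableT_comp mw (@measurable_snd _ _ _ _))].
Qed.

Lemma measurable_weight_graph (T : 'rV[R]_m -> measurableTypeR R) :
  measurable_fun setT T -> measurable_fun setT (fun x => (e x * w (T x))%:E).
Proof.
move=> mT; apply/measurable_EFinP; apply: measurable_funM => //.
exact: (measurableT_comp mw mT).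
Qed.

Lemma measurable_graph_base (A : set ('rV[R]_m * measurableTypeR R))
    (T : 'rV[R]_m -> measurableTypeR R) :
  measurable A -> measurable_fun setT T -> measurable (graph_base A T).
Proof.
move=> mA mT; suff : measurable ((fun x => (x, T x)) @^-1` A) by [].
by apply: measurable_preimage mA; exact: measurable_fun_pair.
Qed.

Lemma measurable_vertical_slice (A : set ('rV[R]_m * measurableTypeR R)) x :
  measurable A -> measurable (vertical_slice A x).
Proof.
by move=> mA; have := measurable_xsection x mA; rewrite xsectionE.
Qed.

Lemma integral_weight_graph (A : set ('rV[R]_m * measurableTypeR R))
    (T : 'rV[R]_m -> measurableTypeR R) (mT : measurable_fun setT T) :
  measurable A ->
  \int[@hausdorff_measure R m]_(z in A `&` graph T) (weight z)%:E =
  \int[graph_area mT]_(x in graph_base A T) (e x * w (T x))%:E.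
Proof.
move=> mA; rewrite integral_graph_area//; last 3 first.
- exact: measurable_graph_base.
- exact: measurable_weight_graph.
- by move=> x; rewrite lee_fin mulr_ge0.
rewrite (_ : fst @^-1` _ `&` _ = A `&` graph T).
  by apply: eq_integral => z; rewrite inE => -[_]; rewrite /graph /weight /= => ->.
by rewrite /graph_base /graph; apply/seteqP; split => -[x t] [/= + tE]; rewrite tE.
Qed.

(** The flat area being a multiple of Lebesgue measure, and at most the area of
    any graph over the same base, it suffices to compare integrals over the base. *)
Lemma weighted_area_flat_le_graph c (A : set ('rV[R]_m * measurableTypeR R))
    (T : 'rV[R]_m -> measurableTypeR R) : measurable A -> measurable_fun setT T ->
  \int[L]_(x in graph_base A (cst c)) (e x * w c)%:E <=
    \int[L]_(x in graph_base A T) (e x * w (T x))%:E ->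
  \int[@hausdorff_measure R m]_(z in A `&` graph (cst c)) (weight z)%:E <=
  \int[@hausdorff_measure R m]_(z in A `&` graph T) (weight z)%:E.
Proof.
move=> mA mT le_base.
have mc : measurable_fun [set: 'rV[R]_m] (cst c : 'rV[R]_m -> measurableTypeR R).
  exact: measurable_cst.
have [l flatE] := @flat_area_lebesgue R m c.
have flat_int (S : 'rV[R]_m -> measurableTypeR R) : measurable_fun setT S ->
    \int[@flat_area R m c]_(x in graph_base A S) (e x * w (S x))%:E =
    l%:num%:E * \int[L]_(x in graph_base A S) (e x * w (S x))%:E.
  move=> mS; have mD := measurable_graph_base mA mS.
  rewrite -ge0_integral_mscale//; last 2 first.
  - by apply: measurable_funTS; exact: measurable_weight_graph.
  - by move=> x _; rewrite lee_fin mulr_ge0.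
  by apply: eq_measure_integral => B mB _; exact: flatE.
rewrite (integral_weight_graph mc)// (integral_weight_graph mT)//.
apply: (@le_trans _ _ (\int[@flat_area R m c]_(x in graph_base A T) (e x * w (T x))%:E)).
  rewrite flat_int//.
  rewrite (_ : \int[graph_area mc]_(x in _) _ =
    \int[@flat_area R m c]_(x in graph_base A (cst c)) (e x * w (cst c x))%:E); last first.
    by apply: eq_measure_integral.
  by rewrite (flat_int (cst c))// lee_wpmul2l// lee_fin.
apply: ge0_le_measure_integral.
- by move=> B mB; exact: flat_area_le_graph_area.
- exact: measurable_graph_base.
- by move=> x; rewrite lee_fin mulr_ge0.
- exact: measurable_weight_graph.
Qed.

Lemma measurable_slice_mass (A : set ('rV[R]_m * measurableTypeR R)) :
  measurable A -> measurable_fun setT (slice_mass A).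
Proof.
move=> mA; pose h := ((fun z : 'rV[R]_m * measurableTypeR R => (w z.2)%:E) \_ A).
have mh : measurable_fun setT h.
  apply/(measurable_restrictT _ mA); apply: measurable_funTS.
  have mw2 : measurable_fun setT (fun z : 'rV[R]_m * measurableTypeR R => w z.2).
    exact: (measurableT_comp mw (@measurable_snd _ _ _ _)).
  exact/measurable_EFinP.
have h0 z : 0 <= h z by apply: erestrict_ge0 => // ? _; rewrite lee_fin.
have := measurable_fun_fubini_tonelli_F (m2 := leb) h mh h0.
congr measurable_fun; apply/funext => x; rewrite /fubini_F /slice_mass [RHS]integral_mkcond.
by apply: eq_integral => t _; rewrite /h /patch.
Qed.

Lemma slice_mass_ge0 A x : 0 <= slice_mass A x.
Proof. by apply: integral_ge0 => t _; rewrite lee_fin. Qed.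

Lemma integral_weight_fubini (A : set ('rV[R]_m * measurableTypeR R)) :
  measurable A ->
  \int[(L \x leb)]_(z in A) (weight z)%:E = \int[L]_x ((e x)%:E * slice_mass A x).
Proof.
move=> mA; rewrite integral_mkcond.
pose h := ((fun z : 'rV[R]_m * measurableTypeR R => (weight z)%:E) \_ A).
have mh : measurable_fun setT h.
  apply/(measurable_restrictT _ mA); apply: measurable_funTS.
  by apply/measurable_EFinP; exact: measurable_weight.
have h0 z : 0 <= h z.
  by apply: erestrict_ge0 => // ? _; rewrite lee_fin mulr_ge0.
rewrite (fubini_tonelli1 (m1 := L) (m2 := leb) h mh h0); apply: eq_integral => x _.
rewrite /fubini_F /slice_mass -ge0_integralZl//; last 4 first.
- exact: measurable_vertical_slice.
- by apply: measurable_funTS; apply/measurable_EFinP.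
- by move=> t _; rewrite lee_fin.
- by rewrite lee_fin.
rewrite [RHS]integral_mkcond; apply: eq_integral => t _.
by rewrite /h /patch /weight EFinM.
Qed.

(** Integrating the slicewise balance turns it into an inequality between the
    base integrals plus [k] times the two volumes, which then cancel. *)
Lemma base_integral_le (c k : R) (A A1 A2 : set ('rV[R]_m * measurableTypeR R))
    (T : 'rV[R]_m -> measurableTypeR R) :
  measurable A -> measurable A1 -> measurable A2 -> measurable_fun setT T ->
  (0 <= k)%R ->
  \int[(L \x leb)]_(z in A1) (weight z)%:E = \int[(L \x leb)]_(z in A2) (weight z)%:E ->
  \int[(L \x leb)]_(z in A1) (weight z)%:E < +oo ->
  (forall x, ~ A (x, T x) -> T x = c) ->
  (forall x, (w c)%:E + k%:E * slice_mass A2 x <= (w (T x))%:E + k%:E * slice_mass A1 x) ->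
  \int[L]_(x in graph_base A (cst c)) (e x * w c)%:E <=
    \int[L]_(x in graph_base A T) (e x * w (T x))%:E.
Proof.
move=> mA mA1 mA2 mT k0 vol volfin TA balance.
have mc : measurable_fun [set: 'rV[R]_m] (cst c : 'rV[R]_m -> measurableTypeR R).
  exact: measurable_cst.
have mP := measurable_graph_base mA mT; have mPc := measurable_graph_base mA mc.
have mwc := measurable_weight_graph mc; have mwT := measurable_weight_graph mT.
have mvol B : measurable B -> measurable_fun setT (fun x => (e x)%:E * slice_mass B x).
  by move=> mB; apply: emeasurable_funM; [exact/measurable_EFinP|exact: measurable_slice_mass].
have wc_ge0 x : 0 <= (e x * w c)%:E by rewrite lee_fin mulr_ge0.
have wT_ge0 x : 0 <= (e x * w (T x))%:E by rewrite lee_fin mulr_ge0.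
have vol_ge0 B x : 0 <= (e x)%:E * slice_mass B x by rewrite mule_ge0 ?lee_fin ?slice_mass_ge0.
apply: (@le_trans _ _ (\int[L]_(x in graph_base A T) (e x * w c)%:E)).
  apply: ge0_subset_integral => //; first exact: measurable_funTS.
  by move=> x /= Ax; apply: contrapT => nAT; apply: (nAT); rewrite /graph_base/= TA.
set I := \int[L]_(x in _) _; set J := \int[L]_(x in _) _.
set V := \int[(L \x leb)]_(z in A1) (weight z)%:E.
have Vfin : k%:E * V \is a fin_num.
  by rewrite fin_numM// ge0_fin_numE// integral_ge0// => z _; rewrite lee_fin mulr_ge0.
have total (f : 'rV[R]_m -> \bar R) B : measurable B -> measurable_fun setT f ->
    (forall x, 0 <= f x) ->
    \int[L]_x ((f \_ (graph_base A T)) x + k%:E * ((e x)%:E * slice_mass B x)) =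
    \int[L]_(x in graph_base A T) f x + k%:E * \int[(L \x leb)]_(z in B) (weight z)%:E.
  move=> mB mf f0; rewrite ge0_integralD//; last 4 first.
  - by move=> x _; exact: erestrict_ge0.
  - by apply/(measurable_restrictT _ mP); exact: measurable_funTS.
  - by move=> x _; rewrite mule_ge0.
  - by apply: emeasurable_funM => //; exact: mvol.
  rewrite -integral_mkcond integral_weight_fubini//; congr (_ + _).
  by rewrite ge0_integralZl//; exact: mvol.
rewrite -(leeD2rE _ _ Vfin) {1}/V vol -!total// /V.
apply: ge0_le_integral => //.
- by move=> x _; rewrite adde_ge0 ?erestrict_ge0// mule_ge0.
- apply: emeasurable_funD; first by apply/(measurable_restrictT _ mP); exact: measurable_funTS.
  by apply: emeasurable_funM => //; exact: mvol.
- apply: emeasurable_funD; first by apply/(measurable_restrictT _ mP); exact: measurable_funTS.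
  by apply: emeasurable_funM => //; exact: mvol.
move=> x _; have bx := balance x.
rewrite !(muleCA k%:E) /patch; case: ifPn => [_|].
  rewrite !EFinM -!ge0_muleDr ?lee_fin// ?mule_ge0 ?slice_mass_ge0 ?lee_fin//.
  by rewrite lee_wpmul2l// lee_fin.
rewrite notin_setE => /TA Tc; rewrite !add0e lee_wpmul2l// ?lee_fin//.
by rewrite Tc leeD2lE in bx.
Qed.

(** [B2] lies between the two heights [u] and [v], so its mass is at most [J],
    which the difference [y - z] of the weights at these heights dominates. *)
Lemma slice_balance_outward (k J y z u v : R) (B1 B2 : set (measurableTypeR R)) :
  measurable B2 -> (0 <= k)%R -> B2 `<=` `[u, v] ->
  \int[leb]_(t in `[u, v]) (w t)%:E = J%:E -> (k * J <= y - z)%R ->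
  z%:E + k%:E * \int[leb]_(t in B2) (w t)%:E <=
  y%:E + k%:E * \int[leb]_(t in B1) (w t)%:E.
Proof.
move=> mB2 k0 B2uv JE kJ.
have B2J : \int[leb]_(t in B2) (w t)%:E <= J%:E.
  rewrite -JE; apply: ge0_subset_integral => //.
    by apply: measurable_funTS; apply/measurable_EFinP.
  by move=> t _; rewrite lee_fin.
apply: (@le_trans _ _ (z%:E + k%:E * J%:E)).
  by rewrite leeD2l// lee_wpmul2l// lee_fin.
apply: (@le_trans _ _ y%:E); first by rewrite -EFinM -EFinD lee_fin; lra.
rewrite leeDl// mule_ge0 ?lee_fin//.
by apply: integral_ge0 => t _; rewrite lee_fin.
Qed.

(** [B1] contains everything between the two heights [u] and [v], so its mass is
    at least [J], which makes up for the deficit [z - y]. *)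
Lemma slice_balance_inward (k J y z u v : R) (B1 B2 : set (measurableTypeR R)) :
  measurable B1 -> (0 <= k)%R -> B2 = set0 -> `[u, v[ `<=` B1 ->
  \int[leb]_(t in `[u, v]) (w t)%:E = J%:E -> (z - y <= k * J)%R ->
  z%:E + k%:E * \int[leb]_(t in B2) (w t)%:E <=
  y%:E + k%:E * \int[leb]_(t in B1) (w t)%:E.
Proof.
move=> mB1 k0 -> uvB1 JE kJ; rewrite integral_set0 mule0 adde0.
have mwE D : measurable_fun D (fun t => (w t)%:E).
  by apply: measurable_funTS; apply/measurable_EFinP.
have JB1 : J%:E <= \int[leb]_(t in B1) (w t)%:E.
  rewrite -JE -(integral_itv_bndo_bndc (mwE _)); apply: ge0_subset_integral => //.
  by move=> t _; rewrite lee_fin.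
apply: (@le_trans _ _ (y%:E + k%:E * J%:E)); last first.
  by rewrite leeD2l// lee_wpmul2l// lee_fin.
by rewrite -EFinM -EFinD lee_fin; lra.
Qed.

End product_weight.

(** * The one-dimensional inequality for a convex exponent *)

Section convex_potential.
Context {R : realType}.
Variables (a b : \bar R) (psi : R -> R).
Hypothesis psi_smooth : smooth_on (oo_interval a b) psi.
Hypothesis psi_convex : convex_function (oo_interval a b) psi.
Notation D := (oo_interval a b).

Lemma oo_interval_open : open D.
Proof.
by apply: openI; [exact: open_ereal_gt|exact: open_ereal_lt].
Qed.

Lemma oo_interval_between u v t : D u -> D v -> u <= t <= v -> D t.
Proof.
move=> [au _] [_ vb] /andP[ut tv]; split.
  by apply: lt_le_trans au _; rewrite lee_fin.
by apply: le_lt_trans vb; rewrite lee_fin.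
Qed.

Let psi_diff x : D x -> differentiable psi x.
Proof. by move=> Dx; exact: (psi_smooth [::]). Qed.

Lemma smooth_on_continuous x : D x -> {for x, continuous psi}.
Proof. by move=> Dx; exact/differentiable_continuous/psi_diff. Qed.

Let psi'_cont x : D x -> {for x, continuous ('D_1 psi : R -> R)}.
Proof.
by move=> Dx; apply: differentiable_continuous; exact: (psi_smooth [:: 1]).
Qed.

(** Convexity bounds the difference quotients of [psi] at [u] towards [v] by
    [psi v - psi u]; let the step tend to 0 from the right. *)
Lemma convex_tangent_line u v : D u -> D v ->
  psi u + 'D_1 psi u * (v - u) <= psi v.
Proof.
move=> Du Dv; have du := psi_diff Du.
have -> : 'D_1 psi u * (v - u) = 'D_(v - u) psi u.
  rewrite !deriveE// mulrC; transitivity ('d psi u ((v - u) *: 1)).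
    by rewrite linearZZ.
  by rewrite [_ *: _]mulr1.
rewrite addrC -lerBrDr.
have /cvg_dnbhs_at_right : derivable psi u (v - u) by exact: diff_derivable.
move=> /cvgr_to_le; apply; near=> h.
have h0 : 0 < h by near: h; exact: nbhs_right_gt.
have h1 : h <= 1 by near: h; apply: nbhs_right_le.
rewrite -[leLHS]/(h^-1 * (psi (h * (v - u) + u) - psi u)) ler_pdivrMl// lerBlDr.
have := psi_convex (Itv01 (ltW h0) h1) (mem_set Dv) (mem_set Du).
rewrite [leRHS]convRE /= => convex_uv.
rewrite (_ : h * (v - u) + u = h * v + unstable.onem h * u); last by rewrite /unstable.onem; ring.
apply: (le_trans convex_uv); rewrite /unstable.onem; lra.
Unshelve. all: by end_near. Qed.

(** The difference [expR (psi v) - expR (psi u)] is the integral of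
    [psi' * expR psi] over [`[u, v]], and [psi'] is at least [psi' c] above [c] and
    at most [psi' c] below [c]. *)
Lemma weighted_length_comparison c u v : D c -> D u -> D v -> u <= v ->
  exists J : R, [/\ (\int[lebesgue_measure]_(t in `[u, v]) (expR (psi t))%:E = J%:E)%E,
    c <= u -> 'D_1 psi c * J <= expR (psi v) - expR (psi u) &
    v <= c -> expR (psi v) - expR (psi u) <= 'D_1 psi c * J].
Proof.
move=> Dc Du Dv; rewrite le_eqVlt => /predU1P[<-|uv].
  exists 0; rewrite set_itv1 integral_set1; split => // _; by rewrite mulr0 subrr.
pose w t := expR (psi t); pose f t := 'D_1 psi t * w t.
have Duv t : t \in `[u, v] -> D t by rewrite in_itv/=; exact: oo_interval_between.
have cw t : D t -> {for t, continuous w}.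
  move=> Dt; apply: (@continuous_comp _ _ _ psi expR); first exact: smooth_on_continuous.
  exact: continuous_expR.
have cf t : D t -> {for t, continuous f}.
  by move=> Dt; apply: cvgM; [exact: psi'_cont|exact: cw].
have within (g : R -> R) : (forall t, D t -> {for t, continuous g}) ->
    {within `[u, v], continuous g}.
  by move=> cg; apply: continuous_in_subspaceT => t /set_mem tuv; apply/cg/Duv.
have int (g : R -> R) : (forall t, D t -> {for t, continuous g}) ->
    lebesgue_measure.-integrable `[u, v] (EFin \o g).
  by move=> cg; apply: continuous_compact_integrable; [exact: segment_compact|exact: within].
have iw := int _ cw; have if_ := int _ cf.
have FTC : (\int[lebesgue_measure]_(t in `[u, v]) (f t)%:E = (w v)%:E - (w u)%:E)%E.
  have dw t : D t -> is_derive t 1 w (f t).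
    move=> Dt; have dt : is_derive t 1 psi ('D_1 psi t).
      by apply: DeriveDef => //; apply: diff_derivable; exact: psi_diff.
    rewrite /f mulrC; exact: (@is_derive1_comp _ expR psi).
  apply: continuous_FTC2 => //; first exact: within.
    split.
    - by move=> t /subset_itv_oo_cc tuv; apply: ex_derive; apply: dw; exact: Duv.
    - by apply: cvg_at_right_filter; exact: cw.
    - by apply: cvg_at_left_filter; exact: cw.
  move=> t /subset_itv_oo_cc tuv; rewrite derive1E.
  by apply: derive_val; apply: dw; exact: Duv.
exists (\int[lebesgue_measure]_(t in `[u, v]) w t)%R.
have wE : (\int[lebesgue_measure]_(t in `[u, v]) (w t)%:E)%E =
    (\int[lebesgue_measure]_(t in `[u, v]) w t)%R%:E.
  by rewrite /Rintegral fineK//; exact: integrable_fin_num.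
have fE : (\int[lebesgue_measure]_(t in `[u, v]) f t)%R = w v - w u.
  by rewrite /Rintegral FTC.
have icw : lebesgue_measure.-integrable `[u, v] (EFin \o (fun t => 'D_1 psi c * w t)).
  by apply: int => t Dt; apply: cvgM; [exact: cvg_cst|exact: cw].
have mono s t : D s -> D t -> s <= t -> 'D_1 psi s <= 'D_1 psi t.
  move=> Ds Dt; rewrite le_eqVlt => /predU1P[->//|st].
  have h1 := convex_tangent_line Ds Dt; have h2 := convex_tangent_line Dt Ds.
  rewrite -(ler_pM2r (_ : 0 < t - s)) ?subr_gt0//; lra.
split; first exact: wE.
- move=> cu; rewrite -[leRHS]fE -RintegralZl//; apply: le_Rintegral => // t tuv.
  rewrite ler_wpM2r ?expR_ge0//; apply: mono => //; first exact: Duv.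
  by move: tuv; rewrite /= in_itv/= => /andP[/(le_trans cu)].
- move=> vc; rewrite -[leLHS]fE -RintegralZl//; apply: le_Rintegral => // t tuv.
  rewrite ler_wpM2r ?expR_ge0//; apply: mono => //; first exact: Duv.
  by move: tuv; rewrite /= in_itv/= => /andP[_ /le_trans]; apply.
Qed.

End convex_potential.

(** * Measurable choice of a crossing on each vertical line *)

Section crossing.
Context {R : realType} {m : nat}.
Implicit Types (x : 'rV[R]_m) (t c al be : R).

(** [T x] is the largest [t] with [eta (x, t) <= c].  It is measurable because
    [T x < s] means that [eta] exceeds [c] on all of [{x} x [s, be]], an open
    condition on [x] by compactness of [`[s, be]]. *)
Lemma last_crossing (eta : 'rV[R]_m * R -> R) c al be : al <= be ->
  (forall x t, al <= t <= be -> {for (x, t), continuous eta}) ->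
  (forall x, eta (x, al) <= c) -> (forall x, c <= eta (x, be)) ->
  exists T : 'rV[R]_m -> measurableTypeR R, [/\ measurable_fun setT T,
    forall x, al <= T x <= be, forall x, eta (x, T x) = c &
    forall x t, T x < t <= be -> c < eta (x, t)].
Proof.
move=> albe ceta eal ebe.
pose X x := [set t | al <= t <= be /\ eta (x, t) <= c].
have Xal x : X x al by split; rewrite ?lexx.
have Xsup x : has_sup (X x) by split; [exists al|exists be => t [/andP[]]].
pose T x : measurableTypeR R := sup (X x).
have T_in x : al <= T x <= be.
  apply/andP; split; first exact: (ub_le_sup (Xsup x).2 (Xal x)).
  by apply: (ge_sup (Xsup x).1) => t [/andP[]].
have slice x t : al <= t <= be -> eta (x, s) @[s --> t] --> eta (x, t).
  move=> h; have pair_cvg : (fun s => (x, s)) s @[s --> t] --> (x, t).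
    by apply: (@cvg_pair _ _ _ _ (nbhs x) (nbhs t)); [exact: cvg_cst|exact: cvg_id].
  exact: (cvg_comp _ _ pair_cvg (ceta x t h)).
have T_above x t : T x < t <= be -> c < eta (x, t).
  move=> /andP[Tt tbe]; rewrite ltNge; apply/negP => h.
  have : t <= T x.
    apply: (ub_le_sup (Xsup x).2); split => //; rewrite tbe andbT.
    by apply: le_trans (ltW Tt); have /andP[] := T_in x.
  by rewrite leNgt Tt.
have T_le x : eta (x, T x) <= c.
  rewrite leNgt; apply/negP => h.
  have /nbhs_ballP[e /= e0 he] : \forall s \near T x, c < eta (x, s).
    by apply: (cvgr_gt _ (slice x _ (T_in x))).
  have [t Xt tT] := sup_adherent e0 (Xsup x).
  have tT' : t <= T x by exact: (ub_le_sup (Xsup x).2).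
  have : c < eta (x, t).
    apply: he; rewrite -ball_normE/= ger0_norm ?subr_ge0//.
    rewrite -/(T x) in tT; lra.
  by rewrite ltNge Xt.2.
have T_eq x : eta (x, T x) = c.
  apply/eqP; rewrite eq_le T_le leNgt; apply/negP => h.
  have Tbe : T x < be.
    rewrite lt_neqAle; have /andP[_ ->] := T_in x; rewrite andbT.
    by apply/eqP => Tbe; move: h; rewrite Tbe ltNge ebe.
  have /nbhs_ballP[e /= e0 he] : \forall s \near T x, eta (x, s) < c.
    by apply: (cvgr_lt _ (slice x _ (T_in x))).
  pose t := Num.min be (T x + e / 2).
  have tbe : t <= be by rewrite ge_min lexx.
  have Tt : T x < t by rewrite lt_min Tbe ltrDl divr_gt0.
  have tT : t <= T x + e / 2 by rewrite ge_min lexx orbT.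
  have : eta (x, t) < c.
    apply: he; rewrite -ball_normE/= ler0_norm ?subr_le0 ?ltW//; lra.
  by rewrite ltNge ltW// T_above// Tt.
exists T; split => //.
apply: (measurability _ (RGenInftyO.measurableE R)).
move=> _ [_ [s ->] <-]; rewrite setTI.
have [sal|als] := leP s al.
  rewrite (_ : _ @^-1` _ = set0)//; apply/seteqP; split => // x /=.
  rewrite in_itv/= => h; have /andP[+ _] := T_in x.
  by rewrite leNgt (lt_le_trans h).
rewrite (_ : _ @^-1` _ = [set x | `[s, be]%classic `<=` [set t | c < eta (x, t)]]); last first.
  apply/seteqP; split => x /=; rewrite in_itv/= => h.
    by move=> t /=; rewrite in_itv/= => /andP[st tbe]; rewrite T_above// (lt_le_trans h).
  rewrite ltNge; apply/negP => sT; have : c < eta (x, T x).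
    by apply: h; rewrite /= in_itv/= sT; have /andP[] := T_in x.
  by rewrite T_eq ltxx.
apply: open_measurable_rV; rewrite openE => x /= cx.
have := (compact_near_coveringP `[s, be]).1 (@segment_compact _ _ _) _ (nbhs x)
  (fun y t => c < eta (y, t)).
apply => t tin; have := cx t tin => /= h.
have tin' : al <= t <= be.
  by move: tin; rewrite /= in_itv/= => /andP[st ->]; rewrite (le_trans (ltW als)).
have /(cvgr_gt _) /(_ _ h) : eta z @[z --> (x, t)] --> eta (x, t) by exact: ceta.
move=> [[A B] /= [nA nB] AB]; exists (B, A) => // -[s' y] [/= Bs Ay].
exact: (AB (y, s')).
Qed.

(** The reflection [t |-> - t], [eta |-> - eta] exchanges first and last
    crossings. *)
Lemma first_crossing (eta : 'rV[R]_m * R -> R) c al be : al <= be ->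
  (forall x t, al <= t <= be -> {for (x, t), continuous eta}) ->
  (forall x, eta (x, al) <= c) -> (forall x, c <= eta (x, be)) ->
  exists T : 'rV[R]_m -> measurableTypeR R, [/\ measurable_fun setT T,
    forall x, al <= T x <= be, forall x, eta (x, T x) = c &
    forall x t, al <= t < T x -> eta (x, t) < c].
Proof.
move=> albe ceta eal ebe.
have [||||T [mT Tin TE Tlt]] := @last_crossing
    (fun z => - eta (z.1, - z.2)) (- c) (- be) (- al).
- by rewrite lerN2.
- move=> x t /andP[h1 h2]; apply: cvgN.
  have : {for (x, - t), continuous eta} by apply: ceta; apply/andP; split; lra.
  have flip_cvg : (fun z : 'rV[R]_m * R => (z.1, - z.2)) z @[z --> (x, t)] --> (x, - t).
    by apply: (@cvg_pair _ _ _ _ (nbhs x) (nbhs (- t)));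
      [exact: cvg_fst|apply: cvgN; exact: cvg_snd].
  exact: (cvg_comp _ _ flip_cvg).
- by move=> x /=; rewrite opprK lerN2.
- by move=> x /=; rewrite opprK lerN2.
exists (fun x => - T x); split.
- exact: (measurableT_comp (@oppr_measurable R setT) mT).
- by move=> x; have /andP[] := Tin x => *; apply/andP; split; lra.
- by move=> x; have /= := TE x => /eqP; rewrite eqr_opp => /eqP.
- move=> x t /andP[h1 h2]; have := Tlt x (- t); rewrite /= opprK ltrN2; apply.
  by apply/andP; split; lra.
Qed.

End crossing.

(** * Horizontal hyperplanes *)

Section horizontal.
Context {R : realType} {m : nat}.
Variables (a b : \bar R) (phi : 'rV[R]_m -> R) (psi : R -> R) (c : R).
Hypothesis phi_smooth : smooth_on [set: 'rV[R]_m] phi.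
Hypothesis psi_smooth : smooth_on (oo_interval a b) psi.
Hypothesis psi_convex : convex_function (oo_interval a b) psi.
Hypothesis hc : oo_interval a b c.
Local Notation E := ('rV[R]_m * R)%type.
Local Notation D := (oo_interval a b).
Local Notation U := (slab m a b).
Local Notation leb := (@lebesgue_measure R).
Local Notation L := (@lebesgue_rV R m).
Local Notation below := (U `&` [set z : E | z.2 < c]).

Lemma slab_open : open U.
Proof.
rewrite /slab setTX; apply: open_comp; last exact: oo_interval_open.
by move=> z _; exact: cvg_snd.
Qed.

Lemma bounds_in_below : bounds_in U [set z : E | z.2 = c] below.
Proof.
have oB : open below.
  apply: openI; first exact: slab_open.
  by apply: (@open_comp _ _ snd [set t | t < c]); [move=> z _; exact: cvg_snd|exact: open_lt].
split=> //.
have /interior_id -> := oB.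
apply/seteqP; split => [z /= zc|z [Uz [clz nB]]].
  have Uz : U z by split => //=; rewrite zc.
  split => //; split; last by move=> [_ /=]; rewrite zc ltxx.
  move=> B /nbhs_ballP[e /= e0 eB].
  have /nbhs_ballP[d /= d0 dU] : nbhs z U by apply: open_nbhs_nbhs; split => //; exact: slab_open.
  pose r := Num.min e d / 2.
  have r0 : 0 < r by rewrite divr_gt0// lt_min e0 d0.
  have re : r < e by rewrite ltr_pdivrMr// gt_min; apply/orP; left; rewrite ltr_pMr ?ltr1n.
  have rd : r < d by rewrite ltr_pdivrMr// gt_min; apply/orP; right; rewrite ltr_pMr ?ltr1n.
  have bz s : r < s -> ball z s (z.1, z.2 - r).
    move=> rs; split; first by apply: ballxx; apply: lt_trans rs.
    by rewrite -ball_normE/= opprB addrC subrK gtr0_norm.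
  exists (z.1, z.2 - r); split; last exact/eB/bz.
  by split; [exact/dU/bz|rewrite /= zc ltrBlDr ltrDl].
apply/eqP; rewrite eq_le; apply/andP; split.
  have : closed [set z : E | z.2 <= c].
    apply: (@closed_comp _ _ snd [set t | t <= c]); last exact: closed_le.
    by move=> z' _; exact: cvg_snd.
  apply; apply: closure_subset clz => z' [_ /=]; exact: ltW.
by rewrite leNgt; apply/negP => zc; apply: nB.
Qed.

Lemma compact_slab_bounds (K : set E) : compact K -> K `<=` U ->
  exists al be, [/\ D al, D be, al <= c <= be & forall z, K z -> al < z.2 < be].
Proof.
move=> cK KU; pose C := (snd @` K) `|` [set c].
have cC : compact C.
  apply: compactU; last exact: compact_set1.
  apply: continuous_compact cK; apply: continuous_subspaceT => z; exact: cvg_snd.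
have C0 : C !=set0 by exists c; right.
have CD : C `<=` D by move=> _ [[z /KU[_ Dz] <-]|->].
have cid : {within C, continuous (idfun : R -> R)}.
  by apply: continuous_subspaceT => t; exact: cvg_id.
have [M /set_mem CM hM] := compact_EVT_max C0 cC cid.
have [N /set_mem CN hN] := compact_EVT_min C0 cC cid.
have room t : D t -> exists2 r : R, 0 < r & D (t - r) /\ D (t + r).
  move=> Dt; have /nbhs_ballP[r /= r0 rD] : nbhs t D.
    by apply: open_nbhs_nbhs; split => //; exact: oo_interval_open.
  exists (r / 2); first by rewrite divr_gt0.
  by split; apply: rD; rewrite -ball_normE/= ltr_norml; apply/andP; split; lra.
have [r r0 [_ DMr]] := room M (CD _ CM).
have [s s0 [DNs _]] := room N (CD _ CN).
have bd t : C t -> N - s < t < M + r.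
  move=> Ct; have /= := hM t (mem_set Ct); have /= := hN t (mem_set Ct).
  by move=> *; apply/andP; split; lra.
exists (N - s), (M + r); split => //.
  by have /andP[h1 h2] := bd c (or_intror erefl); rewrite !ltW.
by move=> z Kz; apply: bd; left; exists z.
Qed.

Let e (x : 'rV[R]_m) : measurableTypeR R := expR (phi x).
(* [psi] is only controlled on the interval, so its exponential is cut off there
   to obtain a function that is measurable on the whole line. *)
Let w : measurableTypeR R -> measurableTypeR R := (fun t => expR (psi t)) \_ D.

Let w_in t : D t -> w t = expR (psi t).
Proof. by move=> Dt; rewrite /w patchE mem_set. Qed.

Let w_ge0 t : 0 <= w t.
Proof. by rewrite /w patchE; case: ifPn => // _; exact: expR_ge0. Qed.

Let e_ge0 x : 0 <= e x.
Proof. exact: expR_ge0. Qed.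

Let mw : measurable_fun setT w.
Proof.
apply/(measurable_restrictT _ (open_measurable (@oo_interval_open R a b))).
apply: open_continuous_measurable_fun; first exact: oo_interval_open.
move=> t /set_mem Dt; apply: (@continuous_comp _ _ _ psi expR).
  exact: (smooth_on_continuous psi_smooth).
exact: continuous_expR.
Qed.

Let phi_cont : continuous phi.
Proof.
by move=> x; apply: differentiable_continuous; exact: (phi_smooth [::]).
Qed.

Let me : measurable_fun setT e.
Proof.
apply: (measurableT_comp (@measurable_expR R)); exact: continuous_measurable_rV.
Qed.

Lemma product_density_weight z : U z -> product_density phi psi z = weight e w z.
Proof. by move=> [_ Dz]; rewrite /product_density /weight expRD w_in. Qed.

Lemma weighted_volume_weight (A : set E) : A `<=` U ->
  weighted_volume (product_density phi psi) A =
  (\int[(L \x leb)]_(z in A) (weight e w z)%:E)%E.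
Proof.
move=> AU; apply: eq_integral => z /set_mem/AU Uz.
by rewrite product_density_weight.
Qed.

Lemma weighted_area_weight (A : set E) : A `<=` U ->
  weighted_area (product_density phi psi) A =
  (\int[@hausdorff_measure R m]_(z in A) (weight e w z)%:E)%E.
Proof.
move=> AU; rewrite /weighted_area.
transitivity (\int[@hausdorff_measure R m]_(z in A)
    (product_density phi psi z)%:E)%E; first by [].
by apply: eq_integral => z /set_mem/AU Uz; rewrite product_density_weight.
Qed.

(** The finiteness that lets the equal volumes be cancelled. *)
Lemma compact_volume_fin (K : set E) (A : set ('rV[R]_m * measurableTypeR R)) :
  compact K -> K `<=` U -> measurable A -> A `<=` K ->
  (\int[(L \x leb)]_(z in A) (weight e w z)%:E < +oo)%E.
Proof.
move=> cK KU mA AK.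
have cd : {within K, continuous (product_density phi psi)}.
  apply: continuous_in_subspaceT => z /set_mem/KU[_ Dz].
  apply: (@continuous_comp _ _ _ (fun z : E => phi z.1 + psi z.2) expR); last first.
    exact: continuous_expR.
  apply: cvgD.
    apply: (@continuous_comp _ _ _ fst phi); [exact: cvg_fst|exact: phi_cont].
  apply: (@continuous_comp _ _ _ snd psi); first exact: cvg_snd.
  exact: (smooth_on_continuous psi_smooth).
have [M [_ /(_ (M + 1))]] := compact_bounded (continuous_compact cd cK).
rewrite ltrDl ltr01 => /(_ isT) hM.
have [N [_ /(_ (N + 1))]] := compact_bounded cK.
rewrite ltrDl ltr01 => /(_ isT) hN.
have {}hM z : A z -> weight e w z <= M + 1.
  move=> Az; rewrite -product_density_weight; last exact/KU/AK.
  apply: le_trans (ler_norm _) _; apply: hM; exists z => //; exact: AK.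
have [->|/set0P[z0 Az0]] := eqVneq A set0; first by rewrite integral_set0 ltry.
have M0 : 0 <= M + 1 by apply: le_trans (hM z0 Az0); exact: mulr_ge0.
pose B := rV_box (N + 2) `*` `[- (N + 2), N + 2]%classic : set ('rV[R]_m * measurableTypeR R).
have N0 : 0 <= N + 2.
  by have := hN z0 (AK _ Az0) => /(le_trans (normr_ge0 _)); lra.
have mB : measurable B by apply: measurableX; [exact: measurable_rV_box|exact: measurable_itv].
have AB : A `<=` B.
  move=> z Az; have zN := hN z (AK _ Az).
  have : ball (0 : E) (N + 2) z.
    by rewrite -ball_normE/= sub0r normrN (le_lt_trans zN)// ltrD2l ltr1n.
  move=> [[_ h1] h2]; split => /=.
    by move=> i; have := h1 ord0 i; rewrite mxE -ball_normE/= sub0r normrN => /ltW.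
  by move: h2; rewrite -ball_normE/= sub0r normrN in_itv/= -ler_norml => /ltW.
have mwt := measurable_weight me mw.
apply: (@le_lt_trans _ _ (\int[(L \x leb)]_(z in B) (M + 1)%:E)%E).
  apply: (@le_trans _ _ (\int[(L \x leb)]_(z in A) (M + 1)%:E)%E).
    apply: ge0_le_integral => //.
    - by move=> z _; rewrite lee_fin mulr_ge0.
    - by apply: measurable_funTS; apply/measurable_EFinP.
  by apply: ge0_subset_integral => // z _; rewrite lee_fin.
have fB : ((L \x leb) B = ((N + 2 + (N + 2)) ^+ m * (N + 2 + (N + 2)))%:E)%E.
  rewrite /B product_measure1E//; last exact: measurable_rV_box.
  rewrite EFinM; congr (_ * _)%E; first exact: lebesgue_rV_box.
  have := @lebesgue_measure_itv R `[- (N + 2), N + 2] => /= ->.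
  rewrite lte_fin; case: ltP => h; first by rewrite -EFinB opprK.
  by congr (_%:E); lra.
by rewrite integral_cst// [X in (_ * X)%E]fB -EFinM ltry.
Qed.

Local Notation S := [set z : E | z.2 = c].

(** The sets [G] and [G'] below are what the deformed region gains and loses.
    If [psi' c >= 0], take for [T] the last crossing: where [T x < c], the loss
    covers everything between the two heights and there is no gain; where
    [c <= T x], the gain lies between the two heights.  If [psi' c < 0], the first
    crossing does the same with gain and loss exchanged. *)
Lemma weighted_area_horizontal_le (K : set E) (f g : E -> E) :
  compact K -> K `<=` U -> set_fun U U f -> set_fun U U g ->
  (forall z, U z -> g (f z) = z) -> (forall z, U z -> f (g z) = z) ->
  (forall z, U z -> {for z, continuous g}) ->
  (forall z, U z -> ~ K z -> f z = z) ->
  weighted_volume (product_density phi psi) (f @` below `\` below) =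
    weighted_volume (product_density phi psi) (below `\` f @` below) ->
  (weighted_area (product_density phi psi) (S `&` K) <=
   weighted_area (product_density phi psi) (f @` S `&` K))%E.
Proof.
move=> cK KU fU gU gf fg cg f_out vol.
have [al [be [Dal Dbe /andP[alc cbe] Kab]]] := compact_slab_bounds cK KU.
have albe := le_trans alc cbe.
have Dab t : al <= t <= be -> D t by exact: oo_interval_between.
have SU : S `<=` U by move=> z /= zc; split => //; rewrite zc.
pose eta (z : E) : R := (g z).2.
have g_out z : U z -> ~ K z -> g z = z by move=> Uz nKz; rewrite -{1}(f_out z)// gf.
have eta_out z : U z -> ~ K z -> eta z = z.2 by move=> Uz nKz; rewrite /eta g_out.
have ceta z : U z -> {for z, continuous eta}.
  by move=> Uz; apply: (@continuous_comp _ _ _ g snd); [exact: cg|exact: cvg_snd].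
have imE (P : set R) : f @` (U `&` [set z | P z.2]) = U `&` [set z | P (eta z)].
  apply/seteqP; split => [_ [z [Uz Pz] <-]|z [Uz Pz]].
    by split; [exact: fU|rewrite /eta /= gf].
  by exists (g z); [split; [exact: gU|]|exact: fg].
have belowE : f @` below = U `&` [set z | eta z < c] by exact: (imE [set t | t < c]).
have SE : f @` S = U `&` [set z | eta z = c].
  by rewrite -(imE [set t | t = c]); congr image; apply/esym/setIidPr.
have open_eta (P : set R) : open P -> open (U `&` [set z | P (eta z)]).
  move=> oP; rewrite openE => z [Uz Pz]; apply: filterI.
    by apply: open_nbhs_nbhs; split => //; exact: slab_open.
  by apply: (ceta z Uz); apply: open_nbhs_nbhs.
have m_lt : measurable (U `&` [set z | eta z < c] : set ('rV[R]_m * measurableTypeR R)).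
  by apply: open_measurable_prod; exact: (open_eta _ (@open_lt _ c)).
have m_gt : measurable (U `&` [set z | c < eta z] : set ('rV[R]_m * measurableTypeR R)).
  by apply: open_measurable_prod; exact: (open_eta _ (@open_gt _ c)).
have m_below : measurable (below : set ('rV[R]_m * measurableTypeR R)).
  by apply: open_measurable_prod; have [] := bounds_in_below.
have mK : measurable (K : set ('rV[R]_m * measurableTypeR R)).
  by apply: closed_measurable_prod; exact: compact_closed.
rewrite belowE in vol; rewrite SE.
set G := (U `&` [set z | eta z < c]) `\` below in vol.
set G' := below `\` (U `&` [set z | eta z < c]) in vol.
have mG : measurable (G : set ('rV[R]_m * measurableTypeR R)) by exact: measurableD.
have mG' : measurable (G' : set ('rV[R]_m * measurableTypeR R)) by exact: measurableD.
have GK : G `<=` K.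
  move=> z [[Uz /= ez] nB]; apply: contrapT => nK; apply: nB; split => //=.
  by rewrite -eta_out.
have G'K : G' `<=` K.
  move=> z [[Uz /= ez] nB]; apply: contrapT => nK; apply: nB; split => //=.
  by rewrite eta_out.
have GE x t : G (x, t) <-> [/\ D t, eta (x, t) < c & c <= t].
  split => [[[[_ Dt] /= ez] nB]|[Dt ez ct]].
    by split => //; rewrite leNgt; apply/negP => tc; apply: nB.
  by split => //; move=> [_ /=]; rewrite ltNge ct.
have G'E x t : G' (x, t) <-> [/\ D t, c <= eta (x, t) & t < c].
  split => [[[[_ Dt] /= ez] nB]|[Dt ez ct]].
    by split => //; rewrite leNgt; apply/negP => tc; apply: nB.
  by split => //; move=> [_ /=]; rewrite ltNge ez.
have vol' : (\int[(L \x leb)]_(z in G) (weight e w z)%:E =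
    \int[(L \x leb)]_(z in G') (weight e w z)%:E)%E.
  by move: vol; rewrite !weighted_volume_weight// => z; [move/G'K/KU|move/GK/KU].
have volfin := compact_volume_fin cK KU mG GK.
have volfin' := compact_volume_fin cK KU mG' G'K.
(* Any measurable section [T] of the deformed surface that balances the slices
   gives the inequality; which one to take depends on the sign of [psi' c]. *)
suff [T [mT TD TE [k [A1 [A2 [k0 mA1 mA2 [volA volA1 balance]]]]]]] :
    exists T : 'rV[R]_m -> measurableTypeR R,
    [/\ measurable_fun setT T, forall x, D (T x), forall x, eta (x, T x) = c &
     exists (k : R) (A1 A2 : set ('rV[R]_m * measurableTypeR R)),
     [/\ 0 <= k, measurable A1, measurable A2 & [/\
       (\int[(L \x leb)]_(z in A1) (weight e w z)%:E =
         \int[(L \x leb)]_(z in A2) (weight e w z)%:E)%E,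
       (\int[(L \x leb)]_(z in A1) (weight e w z)%:E < +oo)%E &
       forall x, ((w c)%:E + k%:E * slice_mass w A2 x <=
         (w (T x))%:E + k%:E * slice_mass w A1 x)%E]]].
  rewrite !weighted_area_weight; [|by move=> z [_ /KU]..].
  have -> : S `&` K = K `&` graph (cst c) by rewrite setIC.
  apply: (@le_trans _ _ (\int[@hausdorff_measure R m]_(z in K `&` graph T)
      (weight e w z)%:E)%E).
    apply: (weighted_area_flat_le_graph me mw e_ge0 w_ge0) => //.
    apply: (base_integral_le me mw e_ge0 w_ge0 mK mA1 mA2 mT k0 volA volA1) => // x nK.
    by rewrite -(TE x) eta_out//; split => //=; exact: TD.
  have mSK : measurable (U `&` [set z | eta z = c] `&` K : set ('rV[R]_m * measurableTypeR R)).
    rewrite (_ : _ `&` K =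
        (K `\` (U `&` [set z | eta z < c])) `\` (U `&` [set z | c < eta z])).
      by apply: measurableD => //; exact: measurableD.
    apply/seteqP; split => [z [[Uz /= ez] Kz]|z [[Kz n1] n2]].
      by split; [split => // -[_ /=]|move=> [_ /=]]; rewrite ez ltxx.
    have Uz := KU _ Kz; split => //; split => //=.
    have [h|h|//] := ltgtP (eta z) c; first by exfalso; apply: n1.
    by exfalso; apply: n2.
  apply: ge0_subset_integral.
  - by apply: measurableI; [exact: measurable_hausdorff|exact: measurable_graph].
  - exact: measurable_hausdorff.
  - apply: measurable_funTS; apply/measurable_EFinP.
    exact: (measurableT_comp (measurable_weight me mw) (@measurable_id_hausdorff R m m)).
  - by move=> z _; rewrite lee_fin mulr_ge0.
  - move=> [x t] [Kz]; rewrite /graph /= => tT; split => //; split; first exact: KU.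
    by rewrite /= tT TE.
pose p := 'D_1 psi c.
have eta_al x : eta (x, al) <= c.
  by rewrite eta_out//= => /Kab; rewrite ltxx.
have eta_be x : c <= eta (x, be).
  by rewrite eta_out//= => /Kab /andP[_]; rewrite ltxx.
have ceta' x t : al <= t <= be -> {for (x, t), continuous eta}.
  by move=> tab; apply: ceta; split => //=; exact: Dab.
have G_in x t : G (x, t) -> al <= t <= be.
  by move=> /GK /Kab /andP[h1 h2]; apply/andP; split; exact: ltW.
have G'_in x t : G' (x, t) -> al <= t <= be.
  by move=> /G'K /Kab /andP[h1 h2]; apply/andP; split; exact: ltW.
have wJ u v J : D u -> D v ->
    (\int[leb]_(t in `[u, v]) (expR (psi t))%:E = J%:E ->
     \int[leb]_(t in `[u, v]) (w t)%:E = J%:E)%E.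
  move=> Du Dv <-; apply: eq_integral => t; rewrite inE /= in_itv/= => tuv.
  by rewrite w_in//; exact: oo_interval_between tuv.
have comparison := weighted_length_comparison psi_smooth psi_convex hc.
have [p0|p0] := leP 0 p.
  have [T [mT Tab TE T_above]] := last_crossing albe ceta' eta_al eta_be.
  exists T; split => //; first by move=> x; exact: Dab.
  exists p, G', G; split => //; split => // x.
  have DT := Dab _ (Tab x); have /andP[alT Tbe] := Tab x.
  rewrite /slice_mass !w_in//.
  have [cT|Tc] := leP c (T x).
    have [J [JE J1 _]] := comparison _ _ hc DT cT.
    apply: (slice_balance_outward mw w_ge0 _ _ _ _ (wJ _ _ _ hc DT JE) (J1 (lexx c))) => //.
    - exact: measurable_vertical_slice.
    - move=> t Gt; have /GE[Dt et ct] := Gt; rewrite /= in_itv/= ct/= leNgt.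
      apply/negP => Tt; have := T_above x t; rewrite Tt; have /andP[_ ->] := G_in _ _ Gt.
      by move=> /(_ isT); rewrite ltNge (ltW et).
  have [J [JE _ J2]] := comparison _ _ DT hc (ltW Tc).
  apply: (slice_balance_inward mw w_ge0 _ _ _ _ (wJ _ _ _ DT hc JE) (J2 (lexx c))) => //.
  - exact: measurable_vertical_slice.
  - apply/seteqP; split => // t Gt; have /GE[Dt et ct] := Gt.
    have := T_above x t; rewrite (lt_le_trans Tc ct); have /andP[_ ->] := G_in _ _ Gt.
    by move=> /(_ isT); rewrite ltNge (ltW et).
  - move=> t; rewrite /= in_itv/= => /andP[Tt tc]; apply/G'E.
    have tab : al <= t <= be by rewrite (le_trans alT Tt) (le_trans (ltW tc) cbe).
    split => //; first exact: Dab.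
    have := Tt; rewrite le_eqVlt => /predU1P[<-|Tt']; first by rewrite TE.
    by apply/ltW/T_above; rewrite Tt' (le_trans (ltW tc) cbe).
have [T [mT Tab TE T_below]] := first_crossing albe ceta' eta_al eta_be.
exists T; split => //; first by move=> x; exact: Dab.
exists (- p), G, G'; split => //; first by rewrite oppr_ge0 ltW.
split => // x.
have DT := Dab _ (Tab x); have /andP[alT Tbe] := Tab x.
rewrite /slice_mass !w_in//.
have [cT|Tc] := ltP c (T x).
  have [J [JE J1 _]] := comparison _ _ hc DT (ltW cT).
  apply: (slice_balance_inward mw w_ge0 _ _ _ _ (wJ _ _ _ hc DT JE)) => //.
  - exact: measurable_vertical_slice.
  - by rewrite oppr_ge0 ltW.
  - apply/seteqP; split => // t Gt; have /G'E[Dt et tc] := Gt.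
    have := T_below x t; rewrite (lt_trans tc cT); have /andP[-> _] := G'_in _ _ Gt.
    by move=> /(_ isT); rewrite ltNge et.
  - move=> t; rewrite /= in_itv/= => /andP[ct tT]; apply/GE.
    have tab : al <= t <= be by rewrite (le_trans alc ct) (le_trans (ltW tT) Tbe).
    split => //; first exact: Dab.
    by apply: T_below; rewrite tT (le_trans alc ct).
  - have := J1 (lexx c); rewrite -/p; lra.
have [J [JE _ J2]] := comparison _ _ DT hc Tc.
apply: (slice_balance_outward mw w_ge0 _ _ _ _ (wJ _ _ _ DT hc JE)) => //.
- exact: measurable_vertical_slice.
- by rewrite oppr_ge0 ltW.
- move=> t Gt; have /G'E[Dt et tc] := Gt; rewrite /= in_itv/= (ltW tc) andbT leNgt.
  apply/negP => tT; have := T_below x t; rewrite tT; have /andP[-> _] := G'_in _ _ Gt.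
  by move=> /(_ isT); rewrite ltNge et.
- have := J2 (lexx c); rewrite -/p; lra.
Qed.

End horizontal.

Theorem theorem5p2 (R : realType) (m : nat) (a b : \bar R)
    (phi : 'rV[R]_m -> R) (psi : R -> R)
    (phi_smooth : smooth_on [set: 'rV[R]_m] phi)
    (psi_smooth : smooth_on (oo_interval a b) psi)
    (psi_convex : convex_function (oo_interval a b) psi)
    (c : R) (hc : oo_interval a b c) :
  weighted_area_minimizing (product_density phi psi)
    (slab m a b)
    [set z : 'rV[R]_m * R | z.2 = c]
    (slab m a b `&` [set z : 'rV[R]_m * R | z.2 < c]).
Proof.
split; first exact: bounds_in_below.
move=> K F cK KU [_ diffeo F_out _] /= vol.
have /diffeo[g [fU gU _ sg [gf fg]]] : 0 <= (1 : R) <= 1 by rewrite ler01 lexx.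
apply: (weighted_area_horizontal_le phi_smooth psi_smooth psi_convex hc cK KU fU gU) => //.
- by move=> z Uz; apply: differentiable_continuous; exact: (sg [::]).
- by move=> z Uz nK; apply: F_out; rewrite ?ler01 ?lexx.
Qed.
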